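(* Let $1<p<2<q<\infty$. Then there is a family of closed ideals of $\mathcal{L}(\ell_p,\ell_q)$ which has the cardinality of the continuum, is a chain (i.e. is totally ordered by inclusion), and each of whose members $\mathcal{J}$ satisfies \[ \mathcal{J}^{I_{p,q}}\subset \mathcal{J}\subset \mathcal{J}^{I_{2,q}}. \]
   Context: $\mathcal{L}(X,Y)$ denotes the space of bounded linear operators from the Banach space $X$ to the Banach space $Y$, with the operator norm, and $\mathcal{L}(X)=\mathcal{L}(X,X)$. An ideal of $\mathcal{L}(X,Y)$ is a linear subspace $\mathcal{J}\subset\mathcal{L}(X,Y)$ such that $ATB\in\mathcal{J}$ whenever $A\in\mathcal{L}(Y)$, $T\in\mathcal{J}$ and $B\in\mathcal{L}(X)$; a closed ideal is one closed in the operator norm. For $1\le r<s<\infty$, $I_{r,s}\colon\ell_r\to\ell_s$ is the formal inclusion map, sending the $i$-th unit vector of $\ell_r$ to the $i$-th unit vector of $\ell_s$. For an operator $T\colon U\to V$ between Banach spaces, $\mathcal{J}^T=\mathcal{J}^T(\ell_p,\ell_q)$ is the closure in $\mathcal{L}(\ell_p,\ell_q)$ of the set of finite sums of operators of the form $ATB$ with $A\in\mathcal{L}(V,\ell_q)$, $B\in\mathcal{L}(\ell_p,U)$. *)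

(* Defs.v *)
From HB Require Import structures.
From mathcomp Require Import all_boot all_order all_algebra.
From mathcomp Require Import complex.
From mathcomp Require Import all_classical all_reals all_analysis.

Set Implicit Arguments.
Unset Strict Implicit.
Unset Printing Implicit Defensive.
Import Order.TTheory GRing.Theory Num.Theory.
Import numFieldNormedType.Exports.
Local Open Scope classical_set_scope.
Local Open Scope ring_scope.

Variant scalar_kind := RealScalars | ComplexScalars.

Definition scalar_field (R : realType) (k : scalar_kind) : numFieldType :=
  match k with RealScalars => R | ComplexScalars => complex R end.

(* MathComp norms over a field K take their values in K: [modulus] and
   [of_real] move between K and the underlying reals. *)
Definition modulus (R : realType) (k : scalar_kind) : scalar_field R k -> R :=
  match k with
  | RealScalars => fun x : R => `|x|
  | ComplexScalars => fun x : complex R => complex.Re `|x|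
  end.

Definition of_real (R : realType) (k : scalar_kind) : R -> scalar_field R k :=
  match k with
  | RealScalars => fun x => x
  | ComplexScalars => fun x => Complex x 0
  end.

Section scalar_theory.
Context {R : realType} {k : scalar_kind}.
Local Notation K := (scalar_field R k).
Local Notation of_real := (@of_real R k).
Local Notation modulus := (@modulus R k).

Lemma of_realB : {morph of_real : x y / x - y}.
Proof. by rewrite /of_real; case: k => x y //; rewrite -(rmorphB (real_complex R)). Qed.

Lemma of_realM : {morph of_real : x y / x * y}.
Proof. by rewrite /of_real; case: k => x y //; rewrite -(rmorphM (real_complex R)). Qed.

Lemma of_real1 : of_real 1 = 1. Proof. by rewrite /of_real; case: k. Qed.

HB.instance Definition _ := GRing.isZmodMorphism.Build R K of_real of_realB.
HB.instance Definition _ := GRing.isMonoidMorphism.Build R K of_real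
  (conj of_real1 of_realM).

Lemma of_real0 : of_real 0 = 0. Proof. exact: raddf0. Qed.

Lemma of_realD : {morph of_real : x y / x + y}. Proof. exact: raddfD. Qed.

Lemma ler_of_real : {mono of_real : x y / x <= y}.
Proof. by rewrite /of_real; case: k => x y //; rewrite lecR. Qed.

Lemma of_real_inj : injective of_real.
Proof. exact: inc_inj ler_of_real. Qed.

Lemma of_real_modulus (x : K) : of_real (modulus x) = `|x|.
Proof.
by move: x; rewrite /of_real /modulus; case: k => //= x; rewrite RRe_real// normr_real.
Qed.

Lemma modulus_ge0 (x : K) : 0 <= modulus x.
Proof. by rewrite -ler_of_real raddf0 of_real_modulus. Qed.

Lemma modulus0 : modulus (0 : K) = 0.
Proof. by apply: of_real_inj; rewrite of_real_modulus normr0 raddf0. Qed.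

Lemma modulus0_eq0 (x : K) : modulus x = 0 -> x = 0.
Proof. by move=> x0; apply/normr0_eq0; rewrite -of_real_modulus x0 raddf0. Qed.

Lemma modulusM (x y : K) : modulus (x * y) = modulus x * modulus y.
Proof. by apply: of_real_inj; rewrite rmorphM/= !of_real_modulus normrM. Qed.

Lemma modulusD (x y : K) : modulus (x + y) <= modulus x + modulus y.
Proof. by rewrite -ler_of_real rmorphD/= !of_real_modulus ler_normD. Qed.

Lemma modulus_norm (x : K) : modulus `|x| = modulus x.
Proof. by apply: of_real_inj; rewrite !of_real_modulus normr_id. Qed.

Lemma modulus_of_real (a : R) : modulus (of_real a) = `|a|.
Proof.
apply: of_real_inj; rewrite of_real_modulus; have [a0|/ltW a0] := leP 0 a.
  by rewrite [in RHS]ger0_norm// ger0_norm// -(raddf0 of_real) ler_of_real.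
by rewrite [in RHS]ler0_norm// raddfN ler0_norm// -(raddf0 of_real) ler_of_real.
Qed.

End scalar_theory.

Record exponent (R : realType) :=
  Exponent { exponent_val :> R ; exponent_ge1 : 1 <= exponent_val }.

Definition exponent2 (R : realType) : exponent R := Exponent (ler1n R 2).

(* Locked, as [ell_norm] and [opnorm] below: unification would otherwise unfold
   the series. *)
HB.lock Definition ell_sum (R : realType) (k : scalar_kind) (p : exponent R)
    (x : nat -> scalar_field R k) : \bar R :=
  (\sum_(0 <= n <oo) (modulus (x n) `^ p)%:E)%E.
Canonical ell_sum_unlockable := Unlockable ell_sum.unlock.

Definition ell_pred (R : realType) (k : scalar_kind) (p : exponent R) :
    {pred nat -> scalar_field R k} := [pred x | `[< (ell_sum p x < +oo)%E >]].

Record ell (R : realType) (k : scalar_kind) (p : exponent R) :=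
  Ell { ell_seq :> nat -> scalar_field R k ; ell_seqP : ell_seq \in @ell_pred R k p }.

HB.lock Definition ell_norm (R : realType) (k : scalar_kind) (p : exponent R)
    (x : ell k p) : R :=
  (fine (ell_sum p x)) `^ (p : R)^-1.
Canonical ell_norm_unlockable := Unlockable ell_norm.unlock.

Section ell.
Context {R : realType} (k : scalar_kind) (p : exponent R).
Local Notation K := (scalar_field R k).

Local Notation ell := (@ell R k p).
Local Notation ell_pred := (@ell_pred R k p).
Local Notation ell_sum := (@ell_sum R k p).
Local Notation ell_norm := (@ell_norm R k p).

HB.instance Definition _ := [isSub for @ell_seq R k p].
HB.instance Definition _ := [Choice of ell by <:].

Let p_gt0 : 0 < (p : R).
Proof. exact: lt_le_trans ltr01 (exponent_ge1 p). Qed.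

Lemma ell_sum_ge0 x : (0 <= ell_sum x)%E.
Proof. by rewrite ell_sum.unlock; apply: nneseries_ge0 => n _ _; rewrite lee_fin powR_ge0. Qed.

Lemma ler_ell_sum (x : nat -> K) n : ((modulus (x n) `^ p)%:E <= ell_sum x)%E.
Proof.
rewrite ell_sum.unlock (@nneseriesD1 _ _ n)//; last first.
  by move=> m _; rewrite lee_fin powR_ge0.
by rewrite leeDl// nneseries_ge0// => m _ _; rewrite lee_fin powR_ge0.
Qed.

Lemma ell_predP x : reflect (ell_sum x < +oo)%E (x \in ell_pred).
Proof. exact: asboolP. Qed.

Lemma ell_sum_fineK x : x \in ell_pred -> (fine (ell_sum x))%:E = ell_sum x.
Proof. by move=> /ell_predP xp; rewrite fineK// ge0_fin_numE// ell_sum_ge0. Qed.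

Let LnormE x : Lnorm counting (p : R)%:E (EFin \o (fun n => modulus (x n)))
  = poweR (ell_sum x) (p : R)^-1.
Proof.
rewrite Lnorm_counting// ell_sum.unlock; congr poweR; apply: eq_eseriesr => n _ /=.
by rewrite ger0_norm ?modulus_ge0.
Qed.

Let ell_minkowski (x y : nat -> K) : (poweR (ell_sum (x + y)%R) (p : R)^-1 <=
  poweR (ell_sum x) (p : R)^-1 + poweR (ell_sum y) (p : R)^-1)%E.
Proof.
rewrite -!LnormE; apply: le_trans; last first.
  by apply: minkowski_EFin => //; exact: exponent_ge1.
rewrite !Lnorm_counting// gt0_ler_poweR ?invr_ge0 ?(ltW p_gt0)//.
- by rewrite in_itv/= leey andbT; apply: nneseries_ge0 => n _ _ /=; rewrite lee_fin powR_ge0.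
- by rewrite in_itv/= leey andbT; apply: nneseries_ge0 => n _ _ /=; rewrite lee_fin powR_ge0.
apply: lee_nneseries => n _ /=; first by rewrite lee_fin powR_ge0.
rewrite lee_fin ge0_ler_powR ?nnegrE ?(ltW p_gt0)// !ger0_norm ?addr_ge0 ?modulus_ge0//.
exact: modulusD.
Qed.

Lemma ell_sum0 : ell_sum 0 = 0%E.
Proof.
by rewrite ell_sum.unlock eseries0// => n _ _; rewrite modulus0 powR0// gt_eqF.
Qed.

Lemma ell_sumZ (a : K) (x : nat -> K) :
  ell_sum (a *: x) = ((modulus a `^ p)%:E * ell_sum x)%E.
Proof.
rewrite ell_sum.unlock -nneseriesZl//; last by move=> n _; rewrite lee_fin powR_ge0.
by apply: eq_eseriesr => n _; rewrite -EFinM -powRM ?modulus_ge0// -modulusM.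
Qed.

Lemma ell_submod_closed : submod_closed ell_pred.
Proof.
split=> [|a x y /ell_predP xp /ell_predP yp]; apply/ell_predP.
  by rewrite ell_sum0 ltry.
apply: (@lty_poweRy _ _ (p : R)^-1); first by rewrite gt_eqF ?invr_gt0.
apply: le_lt_trans (ell_minkowski _ _) _; rewrite ell_sumZ.
rewrite lte_add_pinfty// poweR_lty//.
by rewrite lte_mul_pinfty// ?lee_fin ?powR_ge0.
Qed.

HB.instance Definition _ := GRing.isSubmodClosed.Build _ _ ell_pred ell_submod_closed.
HB.instance Definition _ := [SubChoice_isSubLmodule of ell by <:].

Lemma ell_norm_poweR (x : ell) : (ell_norm x)%:E = poweR (ell_sum x) (p : R)^-1.
Proof. by rewrite ell_norm.unlock -poweR_EFin ell_sum_fineK// ell_seqP. Qed.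

Lemma ell_normD (x y : ell) : ell_norm (x + y) <= ell_norm x + ell_norm y.
Proof.
rewrite -lee_fin EFinD !ell_norm_poweR; exact: (ell_minkowski x y).
Qed.

Lemma ell_norm_ge0 (x : ell) : 0 <= ell_norm x.
Proof. by rewrite ell_norm.unlock powR_ge0. Qed.

Lemma ell_normZ (a : K) (x : ell) : ell_norm (a *: x) = modulus a * ell_norm x.
Proof.
rewrite !ell_norm.unlock ell_sumZ fineM//; last by rewrite -ell_sum_fineK ?ell_seqP.
rewrite powRM ?powR_ge0 ?fine_ge0 ?ell_sum_ge0//=.
by rewrite -powRrM mulfV ?gt_eqF// powRr1 ?modulus_ge0.
Qed.

Lemma ell_norm_eq0 (x : ell) : ell_norm x = 0 -> x = 0.
Proof.
rewrite ell_norm.unlock => /powR_eq0_eq0 x0; apply/val_inj/funext => n /=.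
apply/modulus0_eq0/(@powR_eq0_eq0 _ _ (p : R))/le_anti.
rewrite powR_ge0 andbT -lee_fin.
by rewrite (le_trans (ler_ell_sum x n))// -ell_sum_fineK ?ell_seqP// x0.
Qed.

Let ell_normK_D (x y : ell) :
  of_real k (ell_norm (x + y)) <= of_real k (ell_norm x) + of_real k (ell_norm y).
Proof. by rewrite -of_realD ler_of_real ell_normD. Qed.

Let ell_normK_Z (a : K) (x : ell) :
  of_real k (ell_norm (a *: x)) = `|a| * of_real k (ell_norm x).
Proof. by rewrite ell_normZ of_realM of_real_modulus. Qed.

Let ell_normK_eq0 (x : ell) : of_real k (ell_norm x) = 0 -> x = 0.
Proof. by rewrite -(@of_real0 R k) => /of_real_inj; exact: ell_norm_eq0. Qed.

HB.instance Definition _ :=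
  Lmodule_isNormed.Build K ell ell_normK_D ell_normK_Z ell_normK_eq0.

Lemma ell_normE (x : ell) : `|x| = of_real k (ell_norm x).
Proof. by []. Qed.

End ell.

Definition blin_pred (K : numFieldType) (X Y : normedModType K) : {pred X -> Y} :=
  [pred T | `[< linear T /\ continuous T >]].

Record blinop (K : numFieldType) (X Y : normedModType K) :=
  Blinop { blin_fun :> X -> Y ; blin_funP : blin_fun \in @blin_pred K X Y }.

(* The norms of [X] and [Y] have values in [scalar_field R k]; the supremum is taken
   in [R]. *)
HB.lock Definition opnorm (R : realType) (k : scalar_kind)
    (X Y : normedModType (scalar_field R k)) (T : blinop X Y) : R :=
  sup [set modulus `|T x| | x in [set x | `|x| <= 1]].
Canonical opnorm_unlockable := Unlockable opnorm.unlock.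

Section blinop.
Context {R : realType} {k : scalar_kind}.
Local Notation K := (scalar_field R k).
Variables X Y : normedModType K.
Local Notation blin_pred := (@blin_pred K X Y).
Local Notation blinop := (@blinop K X Y).
Local Notation opnorm := (@opnorm R k X Y).

HB.instance Definition _ := [isSub for @blin_fun K X Y].
HB.instance Definition _ := [Choice of blinop by <:].

Lemma blin_predP T : reflect (linear T /\ continuous T) (T \in blin_pred).
Proof. exact: asboolP. Qed.

Lemma blin_submod_closed : submod_closed blin_pred.
Proof.
split=> [|a S T /blin_predP[lS cS] /blin_predP[lT cT]]; apply/blin_predP; split.
- by move=> a x y /=; rewrite scaler0 addr0.
- exact: cst_continuous.
- move=> b x y.
  rewrite -[LHS]/(a *: S _ + T _) -[in RHS]/(b *: (a *: S x + T x) + (a *: S y + T y)).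
  by rewrite lS lT !scalerDr !scalerA mulrC !addrA; congr (_ + _); rewrite addrAC.
- by move=> x; apply: cvgD; [apply: cvgZr; exact: cS|exact: cT].
Qed.

HB.instance Definition _ :=
  GRing.isSubmodClosed.Build _ _ blin_pred blin_submod_closed.
HB.instance Definition _ := [SubChoice_isSubLmodule of blinop by <:].

Lemma blin_linear (T : blinop) : linear T.
Proof. by have /blin_predP[] := blin_funP T. Qed.

Lemma blin_continuous (T : blinop) : continuous T.
Proof. by have /blin_predP[] := blin_funP T. Qed.

HB.instance Definition _ (T : blinop) :=
  GRing.isLinear.Build K X Y *:%R (blin_fun T) (blin_linear T).

Lemma blin_bounded (T : blinop) :
  exists M : R, forall x, `|T x| <= of_real k M * `|x|.
Proof.
have /linear_boundedP/pinfty_ex_gt0[M M0 TM] : bounded_near (T : {linear X -> Y}) (nbhs 0).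
  exact/linear_bounded_continuous/blin_continuous.
by exists (modulus M) => x; rewrite of_real_modulus gtr0_norm//; exact: TM.
Qed.

Lemma opnorm_has_sup (T : blinop) :
  has_sup [set modulus `|T x| | x in [set x | `|x| <= 1]].
Proof.
split; first by exists (modulus `|T 0|), 0 => //=; rewrite normr0.
have [M TM] := blin_bounded T; exists `|M| => _ [x /= x1 <-].
rewrite -(@ler_of_real _ k) of_real_modulus normr_id (le_trans (TM x))//.
have oM : of_real k M <= of_real k `|M| by rewrite ler_of_real ler_norm.
apply: le_trans (ler_wpM2r (normr_ge0 x) oM) _.
by rewrite ler_piMr// -(@of_real0 R k) ler_of_real.
Qed.

Lemma opnorm_ge0 (T : blinop) : 0 <= opnorm T.
Proof.
rewrite unlock; apply: le_trans (modulus_ge0 `|T 0|) (sup_upper_bound (opnorm_has_sup T) _).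
by exists 0 => //=; rewrite normr0.
Qed.

Lemma ler_opnorm (T : blinop) x : `|T x| <= of_real k (opnorm T) * `|x|.
Proof.
have [->|x0] := eqVneq x 0; first by rewrite raddf0 !normr0 mulr0.
rewrite -ler_pdivrMr ?normr_gt0//.
have -> : `|T x| / `|x| = `|T (`|x|^-1 *: x)|.
  by rewrite linearZ normrZ normfV normr_id mulrC.
rewrite -[leLHS]normr_id -of_real_modulus ler_of_real.
rewrite unlock; apply: (sup_upper_bound (opnorm_has_sup T)); exists (`|x|^-1 *: x) => //=.
by rewrite normrZ normfV normr_id mulVf ?normr_eq0.
Qed.

Lemma opnorm_le (T : blinop) (M : R) :
  0 <= M -> (forall x, `|T x| <= of_real k M * `|x|) -> opnorm T <= M.
Proof.
move=> M0 TM; rewrite unlock; apply: ge_sup; first by have [] := opnorm_has_sup T.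
move=> _ [x /= x1 <-]; rewrite -(@ler_of_real _ k) of_real_modulus normr_id.
by rewrite (le_trans (TM x))// ler_piMr// -(@of_real0 R k) ler_of_real.
Qed.

Let opnormD (S T : blinop) :
  of_real k (opnorm (S + T)) <= of_real k (opnorm S) + of_real k (opnorm T).
Proof.
rewrite -of_realD ler_of_real; apply: opnorm_le; first by rewrite addr_ge0 ?opnorm_ge0.
by move=> x; rewrite raddfD mulrDl (le_trans (ler_normD _ _))// lerD ?ler_opnorm.
Qed.

Let opnormZ_le (a : K) (T : blinop) : opnorm (a *: T) <= modulus a * opnorm T.
Proof.
apply: opnorm_le; first by rewrite mulr_ge0 ?modulus_ge0 ?opnorm_ge0.
move=> x; rewrite of_realM of_real_modulus -mulrA.
by rewrite [X in X <= _]normrZ ler_wpM2l ?ler_opnorm.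
Qed.

Let opnormZ (a : K) (T : blinop) :
  of_real k (opnorm (a *: T)) = `|a| * of_real k (opnorm T).
Proof.
rewrite -of_real_modulus -of_realM; congr of_real; apply/le_anti.
rewrite opnormZ_le/=; have [->|a0] := eqVneq a 0.
  by rewrite modulus0 mul0r opnorm_ge0.
rewrite -{1}[T](scalerK a0).
apply: le_trans (ler_wpM2l (modulus_ge0 a) (opnormZ_le _ _)) _.
rewrite mulrA -modulusM mulfV//.
suff -> : modulus (1 : K) = 1 by rewrite mul1r.
by apply: (@of_real_inj R k); rewrite of_real_modulus normr1 rmorph1.
Qed.

Let opnorm_eq0 (T : blinop) : of_real k (opnorm T) = 0 -> T = 0.
Proof.
move=> T0; apply/val_inj/funext => x; apply/eqP; rewrite -normr_le0.
by rewrite (le_trans (ler_opnorm T x))// T0 mul0r.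
Qed.

HB.instance Definition _ :=
  Lmodule_isNormed.Build K blinop opnormD opnormZ opnorm_eq0.

Lemma opnormE (T : blinop) : `|T| = of_real k (opnorm T).
Proof. by []. Qed.

End blinop.

Section ideals.
Context {R : realType} {k : scalar_kind}.
Local Notation K := (scalar_field R k).

Lemma blin_comp_subproof (X Y Z : normedModType K) (S : blinop Y Z)
  (T : blinop X Y) : S \o T \in @blin_pred K X Z.
Proof.
apply/blin_predP; split; first by move=> a x y /=; rewrite !linearP.
by move=> x; apply: continuous_comp; exact: blin_continuous.
Qed.

Definition blin_comp (X Y Z : normedModType K) (S : blinop Y Z) (T : blinop X Y)
  : blinop X Z := Blinop (blin_comp_subproof S T).

Definition is_ideal (X Y : normedModType K) (J : set (blinop X Y)) : Prop :=
  [/\ J 0,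
      forall (a : K) S T, J S -> J T -> J (a *: S + T) &
      forall (A : blinop Y Y) (T : blinop X Y) (B : blinop X X),
        J T -> J (blin_comp A (blin_comp T B))].

Definition is_closed_ideal (X Y : normedModType K) (J : set (blinop X Y)) : Prop :=
  is_ideal J /\ closed J.

Definition ideal_through (X Y U V : normedModType K) (T : blinop U V) :
    set (blinop X Y) :=
  closure [set S | exists n (A : 'I_n -> blinop V Y) (B : 'I_n -> blinop X U),
    S = \sum_(i < n) blin_comp (A i) (blin_comp T (B i))].

End ideals.

Section formal_inclusion.
Context {R : realType} (k : scalar_kind) (r s : exponent R) (rs : (r : R) < (s : R)).
Local Notation K := (scalar_field R k).

Let r_gt0 : 0 < (r : R).
Proof. exact: lt_le_trans ltr01 (exponent_ge1 r). Qed.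

Lemma ell_norm_coord (x : ell k r) n : modulus (x n) <= ell_norm x.
Proof.
have -> : modulus (x n) = (modulus (x n) `^ r) `^ (r : R)^-1.
  by rewrite -powRrM mulfV ?gt_eqF// powRr1 ?modulus_ge0.
rewrite ell_norm.unlock ge0_ler_powR ?nnegrE ?invr_ge0 ?(ltW r_gt0) ?powR_ge0 ?fine_ge0 ?ell_sum_ge0//.
by rewrite -lee_fin ell_sum_fineK ?ell_seqP// ler_ell_sum.
Qed.

Let ell_sum_incl (x : ell k r) :
  (ell_sum s x <= (ell_norm x `^ ((s : R) - (r : R)))%:E * ell_sum r x)%E.
Proof.
rewrite !ell_sum.unlock -nneseriesZl; last by move=> n _; rewrite lee_fin powR_ge0.
apply: lee_nneseries => n _; first by rewrite lee_fin powR_ge0.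
rewrite -EFinM lee_fin; have [->|xn0] := eqVneq (modulus (x n)) 0.
  by rewrite !powR0 ?mulr0 ?gt_eqF// (lt_trans r_gt0).
have -> : modulus (x n) `^ s = modulus (x n) `^ ((s : R) - (r : R)) * modulus (x n) `^ r.
  by rewrite -powRD ?subrK// xn0 implybT.
apply: ler_wpM2r; first exact: powR_ge0.
apply: ge0_ler_powR; rewrite ?nnegrE ?subr_ge0 ?(ltW rs) ?modulus_ge0 ?ell_norm_ge0//.
exact: ell_norm_coord.
Qed.

Lemma ell_incl_subproof (x : ell k r) : (x : nat -> K) \in @ell_pred R k s.
Proof.
apply/ell_predP/(le_lt_trans (ell_sum_incl x)).
by rewrite lte_mul_pinfty ?lee_fin ?powR_ge0//; exact/ell_predP/ell_seqP.
Qed.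

Let incl_fun (x : ell k r) : ell k s := Ell (ell_incl_subproof x).

Let incl_linear : linear incl_fun.
Proof. by move=> a x y; exact/val_inj. Qed.

HB.instance Definition _ :=
  GRing.isLinear.Build K (ell k r) (ell k s) *:%R incl_fun incl_linear.

Let ell_norm_incl (x : ell k r) : ell_norm (incl_fun x) <= ell_norm x.
Proof.
have s0 : 0 < (s : R) by exact: lt_trans rs.
have E : (ell_norm x `^ s) `^ (s : R)^-1 = ell_norm x.
  by rewrite -powRrM mulfV ?gt_eqF// powRr1 ?ell_norm_ge0.
rewrite -[leRHS]E {1}ell_norm.unlock; apply: ge0_ler_powR.
- by rewrite invr_ge0 ltW.
- by rewrite nnegrE fine_ge0 ?ell_sum_ge0.
- by rewrite nnegrE powR_ge0.
rewrite -lee_fin ell_sum_fineK ?ell_seqP// (le_trans (ell_sum_incl x))//.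
rewrite -ell_sum_fineK ?ell_seqP// -EFinM lee_fin.
have -> : fine (ell_sum r x) = ell_norm x `^ r.
  by rewrite ell_norm.unlock -powRrM mulVf ?gt_eqF// powRr1 ?fine_ge0 ?ell_sum_ge0.
by rewrite -powRD ?subrK ?lexx// gt_eqF.
Qed.

Lemma ell_incl_blin : incl_fun \in @blin_pred K (ell k r) (ell k s).
Proof.
apply/blin_predP; split=> //; apply/linear_bounded_continuous/linear_boundedP.
near=> M => x; rewrite (@le_trans _ _ `|x|)//.
  by rewrite !ell_normE ler_of_real ell_norm_incl.
by rewrite ler_peMl//; near: M; exact: nbhs_pinfty_ge.
Unshelve. all: by end_near. Qed.

Definition ell_incl : blinop (ell k r) (ell k s) := Blinop ell_incl_blin.

Lemma ell_inclE (x : ell k r) n : ell_incl x n = x n.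
Proof. by []. Qed.

End formal_inclusion.
Arguments ell_incl {R} k r s rs.

(* Main.v *)
From HB Require Import structures.
Require Import Defs.
From mathcomp Require Import all_boot all_order all_algebra.
From mathcomp Require Import all_classical all_reals all_analysis.
From mathcomp Require Import ring lra zify.
Set Implicit Arguments.
Unset Strict Implicit.
Unset Printing Implicit Defensive.
Import Order.TTheory GRing.Theory Num.Theory.
Import numFieldNormedType.Exports.
Local Open Scope classical_set_scope.
Local Open Scope ring_scope.

(* Take pairwise disjoint planar grids ("blocks"), the n-th one carrying the lines y = c a + b of
   d = n + 1 slopes c, each with r points: a point lies on at most d lines, two lines share at
   most one point.  With 1/p + 1/p' = 1, let T_M send x to the sums of r^(-1/p') x over the lines
   of the blocks in M.  When r is large compared with d, few lines are almost disjoint and a vector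
   of small coefficients is harmless, so that T_M maps l_p boundedly into l_2.  The ideals are
   those generated by T_M : l_p -> l_q, and they increase with M; a continuum of sets M totally
   ordered by inclusion with infinite differences is obtained from the Dedekind cuts of the
   rationals.

   Let f_l in l_p be the normalized indicator of the line l.  The functional
   S |-> average over the lines l of block n of (S f_l)_l has norm at most 1 and takes the value 1
   at T_M when n is in M.  It tends to 0 on A T_M B along the n outside M: as q > 2, only the few
   large coordinates of T_M B f_l matter; blocks below n contain too few lines to contribute, and
   the lines of blocks above n are almost disjoint, whereas random signs give
   E |sum of +-f_l|_p^p <= C N d^(p/2 - 1), with N the number of lines of block n, which is
   negligible with respect to N because p < 2. *)

(** * Elementary inequalities for powers of finite sums *)

Section real_sums.
Context {R : realType}.
Implicit Types (q t : R).

Lemma young_crude (p q a b : R) : 0 <= a -> 0 <= b -> 0 < p -> 0 < q ->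
  p^-1 + q^-1 = 1 -> a * b <= a `^ p + b `^ q.
Proof.
move=> a0 b0 p0 q0 pq.
have p1 : 0 < p^-1 by rewrite invr_gt0.
have q1 : 0 < q^-1 by rewrite invr_gt0.
apply: le_trans (conjugate_powR a0 b0 p0 q0 pq) _.
apply: lerD; rewrite ler_piMr ?powR_ge0//; lra.
Qed.

Lemma powR_le1 q a : 0 <= a <= 1 -> 0 <= q -> a `^ q <= 1.
Proof.
move=> /andP[a0 a1] q0; have -> : 1 = 1 `^ q by rewrite powR1.
by apply: ge0_ler_powR; rewrite ?nnegrE.
Qed.

(** The sum is at most the number of terms times the largest term, whose power is one of the
    summands on the right. The loss $d^q$ is harmless, as line lengths will be large compared with
    powers of $d$. *)
Lemma powR_sum_le (I : Type) (s : seq I) (a : I -> R) (d : nat) q :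
  (forall i, 0 <= a i) -> 0 < q -> (size s <= d)%N ->
  (\sum_(i <- s) a i) `^ q <= d%:R `^ q * \sum_(i <- s) a i `^ q.
Proof.
move=> a0 q0 sd.
(* [m] is the largest term, with 0 for the empty list. *)
have [m [m0 sm mq]] : exists m, [/\ 0 <= m, \sum_(i <- s) a i <= (size s)%:R * m &
    m `^ q <= \sum_(i <- s) a i `^ q].
  elim: s {sd} => [|i s [m [m0 sm mq]]].
    by exists 0; rewrite !big_nil mulr0 powR0 ?gt_eqF.
  exists (Num.max (a i) m); rewrite !big_cons; split.
  - by rewrite le_max a0.
  - rewrite -natr1 mulrDl mul1r addrC lerD ?le_max ?lexx//.
    by apply: le_trans sm _; rewrite ler_wpM2l// le_max lexx orbT.
  - have [_|_] := leP (a i) m.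
      by apply: le_trans mq _; rewrite lerDr powR_ge0.
    by rewrite lerDl sumr_ge0// => j _; rewrite powR_ge0.
have S0 : 0 <= \sum_(i <- s) a i by rewrite sumr_ge0.
apply: (@le_trans _ _ ((d%:R * m) `^ q)).
  apply: ge0_ler_powR; rewrite ?nnegrE ?(ltW q0) ?mulr_ge0//.
  by apply: le_trans sm _; rewrite ler_wpM2r// ler_nat.
by rewrite powRM// ler_wpM2l ?powR_ge0.
Qed.

Lemma powRD_le (x y q : R) : 0 <= x -> 0 <= y -> 0 < q ->
  (x + y) `^ q <= 2 `^ q * (x `^ q + y `^ q).
Proof.
move=> x0 y0 q0.
have := @powR_sum_le bool [:: true; false] (fun b => if b then x else y) 2 q.
by rewrite !big_cons !big_nil !addr0; apply => // -[].
Qed.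

(** If $m\le1$ the first term suffices; otherwise $m(m-1)\ge1$ and the second one does. Later $m$ is
    a number of lines through a point, and $m(m-1)$ counts pairs of such lines. *)
Lemma powR_nat_split (m d : nat) q : 0 < q -> (m <= d)%N ->
  m%:R `^ q <= m%:R + d%:R `^ q * (m * m.-1)%:R :> R.
Proof.
move=> q0 md; case: m md => [|[|m]] md.
- by rewrite powR0 ?gt_eqF// mul0n mulr0 addr0.
- by rewrite powR1 muln0 mulr0 addr0.
rewrite -[leLHS]add0r lerD// -[leLHS]mulr1 ler_pM ?powR_ge0 ?ler1n//.
by apply: ge0_ler_powR; rewrite ?nnegrE ?(ltW q0)// ler_nat.
Qed.

(* At most one of the [a i] exceeds [t], unless the last term, which counts the pairs of
   such indices, dominates. *)
Lemma powR_sum_split (I : eqType) (s : seq I) (a : I -> R) (d : nat) t q :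
  2 < q -> 0 < t -> uniq s -> (size s <= d)%N -> (forall i, 0 <= a i <= 1) ->
  d%:R `^ q * t `^ (q - 2) <= 1 ->
  (\sum_(i <- s) a i) `^ q <= 2 `^ q * (2 * (\sum_(i <- s) a i ^+ 2) +
     d%:R `^ q * t ^- 4 * \sum_(i <- s) \sum_(j <- s | j != i) a i ^+ 2 * a j ^+ 2).
Proof.
move=> q2 t0 us sd a01 dt.
have q0 : 0 < q by apply: lt_trans q2.
have a0 i : 0 <= a i by case/andP: (a01 i).
have a1 i : a i <= 1 by case/andP: (a01 i).
have aq i : a i `^ q = a i `^ (q - 2) * a i ^+ 2.
  rewrite -powR_mulrn// -powRD; first by congr powR; rewrite subrK.
  by apply/implyP => /eqP; lra.
have SS0 : 0 <= \sum_(i <- s) \sum_(j <- s | j != i) a i ^+ 2 * a j ^+ 2.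
  by apply: sumr_ge0 => i _; apply: sumr_ge0 => j _; rewrite mulr_ge0 ?sqr_ge0.
have S20 : 0 <= \sum_(i <- s) a i ^+ 2 by apply: sumr_ge0 => i _; rewrite sqr_ge0.
have two1 : 1 <= 2 `^ q :> R.
  have := @ge0_ler_powR R q (ltW q0) 1 2; rewrite powR1 !nnegrE; apply => //.
  by rewrite ler1n.
(* Cases: no, one, or at least two indices with [a i > t]. The last comes first: there the trivial
   bound $d^q$ is enough, since a single pair already contributes $t^4$ to the double sum. *)
case E : ([seq i <- s | t < a i]) => [|i [|j l]].
3: {
  have uf := seq.filter_uniq (fun i => t < a i) us.
  have : i \in [seq i <- s | t < a i] by rewrite E inE eqxx.
  rewrite mem_filter => /andP[ti is_].
  have : j \in [seq i <- s | t < a i] by rewrite E !inE eqxx orbT.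
  rewrite mem_filter => /andP[tj js].
  have ji : j != i.
    by move: uf; rewrite E /= !inE negb_or eq_sym => /andP[/andP[]].
  have H : t ^+ 4 <= \sum_(i <- s) \sum_(j <- s | j != i) a i ^+ 2 * a j ^+ 2.
    rewrite (bigD1_seq i)//= -[X in _ <= X + _]big_filter (bigD1_seq j) ?mem_filter ?ji ?js ?seq.filter_uniq//= -addrA -[leLHS]addr0 lerD//.
      rewrite (_ : 4 = 2 + 2)%N// exprD ler_pM ?sqr_ge0// lerXn2r ?nnegrE ?(ltW t0)// ltW//.
    rewrite addr_ge0// sumr_ge0// => k _.
      by rewrite mulr_ge0 ?sqr_ge0.
    by apply: sumr_ge0 => ? _; rewrite mulr_ge0 ?sqr_ge0.
  have D : (\sum_(i <- s) a i) `^ q <= d%:R `^ q.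
    apply: ge0_ler_powR; rewrite ?nnegrE ?(ltW q0) ?sumr_ge0//.
    apply: (@le_trans _ _ (\sum_(i <- s) 1)); first exact: ler_sum.
    by rewrite big_const_seq count_predT iter_addr addr0 ler_nat.
  apply: le_trans D _.
  rewrite -[leLHS]mul1r ler_pM ?powR_ge0//.
  apply: (@le_trans _ _ (d%:R `^ q * t ^- 4 * t ^+ 4)).
    by rewrite -mulrA mulVf ?mulr1// expf_neq0// gt_eqF.
  rewrite -[leLHS]add0r lerD//; first by rewrite mulr_ge0.
  by rewrite ler_wpM2l// mulr_ge0 ?powR_ge0// invr_ge0 exprn_ge0// ltW. }
(* With at most one large term, large and small terms are separated. The large one satisfies $a^q\le
   a^2$ because $a\le1$; for the small ones, $d^q t^{q-2}\le1$ turns $q$-th powers into squares. *)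
all: have sz1 : (size [seq i <- s | (t < a i)%R] <= 1)%N by rewrite E.
all: rewrite (bigID (fun i => t < a i))/=.
all: apply: le_trans (powRD_le _ _ q0) _; try by apply: sumr_ge0.
all: rewrite ler_wpM2l ?powR_ge0//.
all: apply: (@le_trans _ _ (2 * (\sum_(i <- s) a i ^+ 2))); last first.
1,3: by rewrite lerDl mulr_ge0// mulr_ge0 ?powR_ge0// invr_ge0 exprn_ge0// ltW.
all: rewrite mulr_natl mulr2n lerD//.
1,3: rewrite -big_filter; apply: le_trans (powR_sum_le a0 q0 sz1) _.
1,2: rewrite powR1 mul1r big_filter big_mkcond/= ler_sum// => k _; case: ifP => // _.
1-4: rewrite ?sqr_ge0//.
1,2: by rewrite aq ler_piMl ?sqr_ge0// powR_le1// subr_ge0 ltW.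
all: rewrite -big_filter; apply: le_trans (@powR_sum_le _ _ a d q a0 q0 _) _.
1,3: by rewrite (leq_trans _ sd)// size_filter count_size.
all: rewrite mulr_sumr big_filter big_mkcond/= ler_sum// => k _; case: ifP => [|_].
2,4: by rewrite sqr_ge0.
all: rewrite -leNgt aq mulrA => kt; rewrite ler_piMl ?sqr_ge0//.
all: apply: le_trans dt; rewrite ler_wpM2l ?powR_ge0//.
all: by apply: ge0_ler_powR; rewrite ?nnegrE ?subr_ge0 ?(ltW t0)// ltW.
Qed.

End real_sums.

(** * Lines in disjoint grids *)

Section lines.
Context (d r : nat -> nat).

(* Lines [(n, c, b)] and points [(n, a, y)] of the n-th block are coded by natural numbers; codes
   that are not those of a line have no point. *)
Definition triple (t : nat * nat * nat) : nat := pickle t.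

Definition untriple (i : nat) : option (nat * nat * nat) := pickle_inv i.

Definition block (i : nat) : nat := if untriple i is Some t then t.1.1 else 0%N.

Definition slope (i : nat) : nat := if untriple i is Some t then t.1.2 else 0%N.

Definition valid_line (t : nat * nat * nat) : bool :=
  (t.1.2 < d t.1.1)%N && (t.2 < d t.1.1 * r t.1.1)%N.

Definition line_points (t : nat * nat * nat) : seq nat :=
  [seq triple (t.1.1, a, t.1.2 * a + t.2)%N | a <- iota 0 (r t.1.1)].

Definition points (i : nat) : seq nat :=
  if untriple i is Some t then if valid_line t then line_points t else [::] else [::].

Lemma tripleK (t : nat * nat * nat) : untriple (triple t) = Some t.
Proof. exact: pickleK_inv. Qed.

Lemma untripleK i t : untriple i = Some t -> triple t = i.
Proof. by move=> it; have := @pickle_invK (nat * nat * nat)%type i; rewrite -/(untriple i) it. Qed.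

Lemma points_triple t : valid_line t -> points (triple t) = line_points t.
Proof. by rewrite /points tripleK => ->. Qed.

Lemma pointsP i u : reflect (exists k c b a, [/\ i = triple (k, c, b), valid_line (k, c, b),
   (a < r k)%N & u = triple (k, a, c * a + b)%N]) (u \in points i).
Proof.
apply: (iffP idP); last first.
  move=> [k [c [b [a [-> v ar ->]]]]]; rewrite points_triple//.
  by apply/mapP; exists a; rewrite // mem_iota.
rewrite /points; case E : untriple => [[[k c] b]|//]; case: ifP => // v.
move=> /mapP[a]; rewrite mem_iota/= add0n => ar ->; exists k, c, b, a.
by split => //; rewrite (untripleK E).
Qed.

Lemma block_triple k c b : block (triple (k, c, b)) = k.
Proof. by rewrite /block tripleK. Qed.

Lemma block_point i u : u \in points i -> block u = block i.
Proof. by move=> /pointsP[k [c [b [a [-> _ _ ->]]]]]; rewrite !block_triple. Qed.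

Lemma triple_inj : injective triple.
Proof. exact: pcan_inj (@pickleK (nat * nat * nat)%type). Qed.

Lemma uniq_points i : uniq (points i).
Proof.
rewrite /points; case: untriple => // t; case: ifP => // _.
by rewrite map_inj_uniq ?iota_uniq// => a b /triple_inj[].
Qed.

Lemma size_points i : points i != [::] -> size (points i) = r (block i).
Proof.
rewrite /points /block; case: untriple => // t; case: ifP => // _ _.
by rewrite size_map size_iota.
Qed.

Lemma size_points_le i : (size (points i) <= r (block i))%N.
Proof. by have [->//|/size_points ->] := eqVneq (points i) [::]. Qed.

Lemma points_meet i j u v : i != j -> u \in points i -> u \in points j ->
  v \in points i -> v \in points j -> u = v.
Proof.
move=> /eqP ij /pointsP[k [c [b [a [ei _ _ ->]]]]] /pointsP[k' [c' [b' [a' [ej _ _ +]]]]].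
move=> /triple_inj[? ? e1] /pointsP[k1 [c1 [b1 [a1 [ei' _ _ ->]]]]]; subst k' a'.
move: ei'; rewrite ei => /triple_inj[? ? ?]; subst k1 c1 b1.
move=> /pointsP[k2 [c2 [b2 [a2 [ej' _ _ +]]]]].
move: ej'; rewrite ej => /triple_inj[? ? ?] /triple_inj[_ ? e2]; subst k2 c2 b2 a2.
suff -> : a = a1 by [].
(* Difference of the equations of the two lines at the two points. Equal slopes would force equal
   intercepts, hence equal lines. *)
have : (c%:Z - c'%:Z) * (a%:Z - a1%:Z) = 0 by nia.
move=> /eqP; rewrite mulf_eq0 => /orP[] /eqP H; last by lia.
have ? : c = c' by lia.
subst c'; have ? : b = b' by lia.
by subst b'; case: ij; rewrite ei ej.
Qed.

(** A line through [u] is determined by its slope, so [slope] maps these lines injectively into the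
    $d$ available slopes. *)
Lemma count_lines u (s : seq nat) : uniq s ->
  (count (fun i => u \in points i) s <= d (block u))%N.
Proof.
move=> us; rewrite -size_filter -(size_map slope) -[leqRHS](size_iota 0).
apply: uniq_leq_size.
  rewrite map_inj_in_uniq ?seq.filter_uniq// => i j.
  rewrite !mem_filter => /andP[/pointsP[k [c [b [a [-> _ _ ->]]]]] _].
  move=> /andP[/pointsP[k' [c' [b' [a' [-> _ _ /triple_inj[<- <- e]]]]]] _].
  by rewrite /slope !tripleK/= => ee; subst c'; congr (triple (_, _, _)); lia.
move=> _ /mapP[i + ->]; rewrite mem_filter mem_iota add0n leq0n/=.
move=> /andP[/pointsP[k [c [b [a [-> /andP[cd _] _ ->]]]]] _].
by rewrite block_triple /slope tripleK.
Qed.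

Definition block_lines (k : nat) : seq nat :=
  [seq triple (k, c, b) | c <- iota 0 (d k), b <- iota 0 (d k * r k)].

(** The range of the ordinates comes from $ca+b<2dr$ for $c<d$, $a<r$, $b<dr$. *)
Definition block_points (k : nat) : seq nat :=
  [seq triple (k, a, y) | a <- iota 0 (r k), y <- iota 0 (2 * (d k * r k))].

Lemma size_block_lines k : size (block_lines k) = (d k ^ 2 * r k)%N.
Proof. by rewrite size_allpairs !size_iota; nia. Qed.

Lemma size_block_points k : size (block_points k) = (2 * d k * r k ^ 2)%N.
Proof. by rewrite size_allpairs !size_iota; nia. Qed.

Lemma uniq_block_lines k : uniq (block_lines k).
Proof. by rewrite allpairs_uniq ?iota_uniq// => -[? ?] [? ?] _ _ /triple_inj[-> ->]. Qed.

Lemma uniq_block_points k : uniq (block_points k).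
Proof. by rewrite allpairs_uniq ?iota_uniq// => -[? ?] [? ?] _ _ /triple_inj[-> ->]. Qed.

Lemma block_linesP k i : reflect (exists c b, i = triple (k, c, b) /\ valid_line (k, c, b))
  (i \in block_lines k).
Proof.
apply: (iffP idP) => [/allpairsP[[c b] [/=]]|[c [b [-> /andP[/= cd bd]]]]].
  by rewrite !mem_iota => cd bd ->; exists c, b; split => //; apply/andP.
by apply/allpairsP; exists (c, b); rewrite !mem_iota.
Qed.

Lemma points_sub k i : i \in block_lines k -> {subset points i <= block_points k}.
Proof.
move=> /block_linesP[c [b [-> /andP[/= cd bd]]]] u.
move=> /pointsP[k' [c' [b' [a [/triple_inj[<- <- <-] _ ar ->]]]]].
apply/allpairsP; exists (a, c * a + b)%N; split => //=; rewrite mem_iota//= add0n; nia.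
Qed.

Lemma mem_block_lines i u : u \in points i -> i \in block_lines (block i).
Proof.
move=> /pointsP[k [c [b [a [-> v _ _]]]]].
by rewrite block_triple; apply/block_linesP; exists c, b.
Qed.

Lemma size_points_block k i : i \in block_lines k -> size (points i) = r k.
Proof.
by move=> /block_linesP[c [b [-> v]]]; rewrite points_triple// size_map size_iota.
Qed.

Lemma block_lines_block k i : i \in block_lines k -> block i = k.
Proof. by move=> /block_linesP[c [b [-> _]]]; rewrite block_triple. Qed.

End lines.

(** * Double counting of incidences, for the adjoint of the line sums *)

Section weights.
Context {R : realType} (d r : nat -> nat) (q : R).
Context (q_gt2 : 2 < q).
Local Notation points := (points d r).

Let q_gt0 : 0 < q. Proof. exact: lt_trans q_gt2. Qed.

(** The factor $r^{-1/p'}$ of $T_M$: the exponent [q] of this section will be $p'$. *)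
Definition weight (i : nat) : R := (r (block i))%:R `^ (- q^-1).

Lemma weight_ge0 i : 0 <= weight i. Proof. exact: powR_ge0. Qed.

Lemma weight_powR i : weight i `^ q = (r (block i))%:R^-1.
Proof. by rewrite -powRrM mulNr mulVf ?gt_eqF// powR_inv1. Qed.

(** After exchanging the sums, [al i] is collected once for each point of the line [i], at most $r$
    times, which cancels $1/r$. A term [ga i j] is collected at most once, as two different lines
    share at most one point. *)
Lemma double_count (s P : seq nat) (F al : nat -> R) (ga : nat -> nat -> R) :
  uniq P -> (forall i, 0 <= al i) -> (forall i j, 0 <= ga i j) ->
  (forall u, F u <= (r (block u))%:R^-1 * (\sum_(i <- s | u \in points i) al i +
     \sum_(i <- s | u \in points i) \sum_(j <- s | (j != i) && (u \in points j)) ga i j)) ->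
  \sum_(u <- P) F u <= \sum_(i <- s) al i +
     \sum_(i <- s) \sum_(j <- s | j != i) (r (block i))%:R^-1 * ga i j.
Proof.
move=> uP al0 ga0 H.
have rV0 k : 0 <= (r k)%:R^-1 :> R by rewrite invr_ge0.
apply: (le_trans (ler_sum _ (fun u _ => H u))).
under eq_bigr do rewrite mulrDr !mulr_sumr.
rewrite big_split/= lerD//.
  rewrite (exchange_big_dep predT)//=; apply: ler_sum => i _.
  rewrite (eq_bigr (fun=> (r (block i))%:R^-1 * al i)); last first.
    by move=> u /block_point ->.
  rewrite big_const_seq iter_addr addr0 -[_ *+ count _ _]mulr_natl mulrA ler_piMl//.
  have [r0|r0] := posnP (r (block i)); first by rewrite r0 invr0 mulr0.
  rewrite ler_pdivrMr ?ltr0n// mul1r ler_nat -size_filter.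
  apply: leq_trans (size_points_le d r i); apply: uniq_leq_size.
    by rewrite seq.filter_uniq.
  by move=> u; rewrite mem_filter => /andP[].
rewrite (exchange_big_dep predT)//=; apply: ler_sum => i _.
under eq_bigr do rewrite mulr_sumr.
rewrite (exchange_big_dep (fun j => j != i))/=; last by move=> ? ? _ /andP[].
apply: ler_sum => j ji.
rewrite (eq_bigr (fun=> (r (block i))%:R^-1 * ga i j)); last first.
  by move=> u /andP[/block_point ->].
rewrite big_const_seq iter_addr addr0 -[_ *+ count _ _]mulr_natl ler_piMl ?mulr_ge0// (ler_nat _ _ 1).
rewrite -size_filter.
set l := [seq _ <- P | _].
have ul : uniq l by rewrite seq.filter_uniq.
case E : l ul => [|u [|v l']]//=; rewrite inE negb_or => /andP[/andP[/eqP uv _] _].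
have : u \in l by rewrite E inE eqxx.
have : v \in l by rewrite E !inE eqxx orbT.
rewrite !mem_filter => /andP[/and3P[vi _ vj] _] /andP[/and3P[ui _ uj] _].
by case: uv; apply: (points_meet _ ui uj vi vj); rewrite eq_sym.
Qed.

(** All lines through [u] lie in the block of [u], so they have a common weight. *)
Lemma weight_sum_powR (s : seq nat) u (a : nat -> R) : (forall i, 0 <= a i) ->
  (\sum_(i <- s | u \in points i) weight i * a i) `^ q =
  (r (block u))%:R^-1 * (\sum_(i <- s | u \in points i) a i) `^ q.
Proof.
move=> a0; rewrite -weight_powR -powRM ?sumr_ge0 ?weight_ge0//.
congr powR; rewrite mulr_sumr; apply: eq_bigr => i /block_point.
by rewrite /weight => ->.
Qed.

(** Few lines are almost disjoint: by [powR_nat_split] and double counting, the incidences cost 1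
    per line, and so do the pairs, since each line is paired with at most [size s] others and
    $d^q|s|/r\le1$. *)
Lemma weight_sum_few (s P : seq nat) : uniq s -> uniq P ->
  (forall i, i \in s -> (d (block i))%:R `^ q * (size s)%:R <= (r (block i))%:R :> R) ->
  \sum_(u <- P) (\sum_(i <- s | u \in points i) weight i) `^ q <= 2 * (size s)%:R.
Proof.
move=> us uP rs.
apply: le_trans (@double_count s P _ (fun=> 1) (fun i j => (d (block i))%:R `^ q)
   uP _ _ _) _ => //.
- move=> u; under eq_bigr do rewrite -[weight _]mulr1.
  rewrite weight_sum_powR// ler_wpM2l ?invr_ge0//.
  rewrite -!(big_filter s (fun i => u \in points i)).
  set l := [seq i <- s | u \in points i].
  have ul : uniq l by rewrite seq.filter_uniq.
  have sl : (size l <= d (block u))%N by rewrite size_filter count_lines.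
  have -> : \sum_(i <- l) 1 = (size l)%:R :> R by rewrite big_const_seq iter_addr addr0 count_predT.
  apply: le_trans (powR_nat_split q_gt0 sl) _; rewrite lerD2l.
  (* The product $m(m-1)$ is rewritten as a sum over ordered pairs of distinct lines through [u]. *)
  rewrite (_ : _ * _ = \sum_(i <- l) (d (block u))%:R `^ q * (size l).-1%:R); last first.
    by rewrite big_const_seq iter_addr addr0 count_predT mulrC natrM -mulrA [_%:R * _ `^ _]mulrC mulr_natl.
  rewrite big_seq [leRHS]big_seq; apply: ler_sum => i il.
  have ui : u \in points i by move: il; rewrite mem_filter => /andP[].
  rewrite -(block_point ui) big_const_seq iter_addr addr0 -[_ *+ count _ _]mulr_natr.
  rewrite ler_wpM2l ?powR_ge0// ler_nat.
  have := count_predC (pred1 i) l; rewrite count_uniq_mem// il => <-.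
  rewrite /= /l count_filter; apply: eq_leq; apply: eq_count => j /=.
  by rewrite andbC.
- rewrite big_const_seq iter_addr addr0 count_predT mulr_natl mulr2n lerD2l.
  apply: (@le_trans _ _ (\sum_(i <- s) 1)); last by rewrite big_const_seq iter_addr addr0 count_predT.
  rewrite big_seq [leRHS]big_seq; apply: ler_sum => i si.
  rewrite big_const_seq iter_addr addr0 -[_ *+ count _ _]mulr_natr -mulrA mulrC.
  have [r0|r0] := posnP (r (block i)); first by rewrite r0 invr0 mulr0.
  rewrite ler_pdivrMr ?ltr0n// mul1r; apply: le_trans (rs i si).
  by rewrite ler_wpM2l ?powR_ge0// ler_nat count_size.
Qed.

(** [powR_sum_split] at each point leaves the squares, which add up to at most 2, and the pairs,
    whose factors $d^q t^{-4}/r\le1$ leave at most $(\sum a_i^2)^2\le1$. *)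
Lemma weight_sum_small (s P : seq nat) (a t : nat -> R) : uniq s -> uniq P ->
  (forall i, 0 <= a i <= 1) -> \sum_(i <- s) a i ^+ 2 <= 1 -> (forall k, 0 < t k) ->
  (forall k, (d k)%:R `^ q * t k `^ (q - 2) <= 1) ->
  (forall k, (d k)%:R `^ q * t k ^- 4 <= (r k)%:R) ->
  \sum_(u <- P) (\sum_(i <- s | u \in points i) weight i * a i) `^ q <= 2 `^ q * 3.
Proof.
move=> us uP a01 a2 t0 dt rt.
have a0 i : 0 <= a i by case/andP: (a01 i).
pose g k := (d k)%:R `^ q * t k ^- 4.
have g0 k : 0 <= g k by rewrite mulr_ge0 ?powR_ge0// invr_ge0 exprn_ge0// ltW.
apply: le_trans (@double_count s P _ (fun i => 2 `^ q * 2 * a i ^+ 2)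
   (fun i j => 2 `^ q * g (block i) * (a i ^+ 2 * a j ^+ 2)) uP _ _ _) _ => //.
- by move=> i; rewrite !mulr_ge0 ?powR_ge0 ?sqr_ge0.
- by move=> i j; apply: mulr_ge0; apply: mulr_ge0; rewrite ?powR_ge0 ?sqr_ge0 ?g0.
- move=> u; rewrite weight_sum_powR// ler_wpM2l ?invr_ge0//.
  rewrite -big_filter; set s' := [seq i <- s | u \in points i].
  apply: le_trans (@powR_sum_split R nat s' a (d (block u)) (t (block u)) q _ _ _ _ _ _) _ => //.
  + by rewrite seq.filter_uniq.
  + by rewrite size_filter count_lines.
  + rewrite mulrDr -!mulr_sumr /s' big_filter mulrA lerD2l -/(g _) big_filter.
    rewrite mulrA mulr_sumr; apply: ler_sum => i ui.
    rewrite mulr_sumr big_filter_cond.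
    under [leRHS]eq_bigl do rewrite andbC.
    by rewrite (block_point ui).
- apply: (@le_trans _ _ (2 `^ q * (2 * (\sum_(i <- s) a i ^+ 2) +
    (\sum_(i <- s) a i ^+ 2) * (\sum_(j <- s) a j ^+ 2)))).
    rewrite [leRHS]mulrDr; apply: lerD; first by rewrite -mulr_sumr mulrA.
    rewrite mulr_suml [leRHS]mulr_sumr.
    apply: ler_sum => i _; rewrite mulr_sumr [leRHS]mulr_sumr big_mkcond/=.
    apply: ler_sum => j _; case: ifP => _; last by rewrite !mulr_ge0 ?powR_ge0 ?sqr_ge0.
    have a4 : 0 <= a i ^+ 2 * a j ^+ 2 by rewrite mulr_ge0 ?sqr_ge0.
    have rg : (r (block i))%:R^-1 * g (block i) <= 1.
      have [r0|r0] := posnP (r (block i)); first by rewrite r0 invr0 mul0r.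
      by rewrite mulrC ler_pdivrMr ?ltr0n// mul1r; exact: rt.
    have -> : (r (block i))%:R^-1 * (2 `^ q * g (block i) * (a i ^+ 2 * a j ^+ 2)) = 2 `^ q * (((r (block i))%:R^-1 * g (block i)) * (a i ^+ 2 * a j ^+ 2)) by ring.
    by rewrite ler_wpM2l ?powR_ge0//; apply: ler_piMl.

  rewrite ler_wpM2l ?powR_ge0//.
  have S0 : 0 <= \sum_(i <- s) a i ^+ 2 by apply: sumr_ge0 => i _; rewrite sqr_ge0.
  nra.
Qed.
End weights.

(** * Sequence spaces and their operators *)

Lemma ler_sum_sub (R : numDomainType) (I : eqType) (s t : seq I) (F : I -> R) :
  (forall i, 0 <= F i) -> uniq s -> {subset s <= t} ->
  \sum_(i <- s) F i <= \sum_(i <- t) F i.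
Proof.
move=> F0; elim: s t => [|i s IH] t; first by rewrite big_nil sumr_ge0.
move=> /= /andP[si us] st; rewrite big_cons.
have it : i \in t by apply: st; rewrite inE eqxx.
rewrite (perm_big _ (perm_to_rem it)) big_cons lerD2l IH// => j js.
have : j \in t by apply: st; rewrite inE js orbT.
rewrite (perm_mem (perm_to_rem it)) inE => /orP[/eqP ji|->//].
by move: js si; rewrite ji => ->.
Qed.

Section ell_finite.
Context {R : realType} {k : scalar_kind}.
Local Notation K := (scalar_field R k).
Local Notation modulus := (@modulus R k).

Lemma exponent_gt0 (p : exponent R) : 0 < (p : R).
Proof. exact: lt_le_trans ltr01 (exponent_ge1 p). Qed.

Lemma powR_invK (p a : R) : 0 < p -> 0 <= a -> (a `^ p) `^ p^-1 = a.
Proof. by move=> p0 a0; rewrite -powRrM mulfV ?gt_eqF// powRr1. Qed.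

Lemma modulus1 : modulus 1 = 1.
Proof. by apply: (@of_real_inj R k); rewrite of_real_modulus normr1 rmorph1. Qed.

Lemma modulusN (x : K) : modulus (- x) = modulus x.
Proof. by apply: (@of_real_inj R k); rewrite !of_real_modulus normrN. Qed.

Lemma modulus_sum (I : Type) (s : seq I) (P : pred I) (F : I -> K) :
  modulus (\sum_(i <- s | P i) F i) <= \sum_(i <- s | P i) modulus (F i).
Proof.
elim/big_ind2 : _ => //; first by rewrite modulus0.
by move=> x a y b xa yb; apply: le_trans (modulusD _ _) (lerD xa yb).
Qed.

Variable p : exponent R.

Let p_gt0 := exponent_gt0 p.

Lemma ell_sum_le (x : nat -> K) (C : R) :
  (forall N, \sum_(i <- iota 0 N) modulus (x i) `^ p <= C) -> (ell_sum p x <= C%:E)%E.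
Proof.
move=> H; rewrite ell_sum.unlock; apply: lime_le.
  by apply: is_cvg_nneseries => n _ _; rewrite lee_fin powR_ge0.
by apply: nearW => N; rewrite sumEFin lee_fin /index_iota subn0.
Qed.

Lemma ell_sum_ge (x : nat -> K) (s : seq nat) : uniq s ->
  ((\sum_(i <- s) modulus (x i) `^ p)%:E <= ell_sum p x)%E.
Proof.
move=> us; rewrite ell_sum.unlock.
apply: le_trans (@nneseries_lim_ge _ _ xpredT 0 (\max_(i <- s) i).+1 _); last first.
  by move=> n _ _; rewrite lee_fin powR_ge0.
rewrite sumEFin lee_fin /index_iota subn0.
have ss : {subset s <= iota 0 (\max_(i <- s) i).+1}.
  by move=> i si; rewrite mem_iota add0n ltnS; apply: leq_bigmax_seq.
by apply: ler_sum_sub => // i; rewrite powR_ge0.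
Qed.

Lemma ell_norm_powR (x : ell k p) : (ell_norm x `^ p)%:E = ell_sum p x.
Proof.
rewrite ell_norm.unlock -powRrM mulVf ?gt_eqF// powRr1 ?fine_ge0 ?ell_sum_ge0//.
by rewrite ell_sum_fineK// ell_seqP.
Qed.

Lemma ell_norm_powR_ge (x : ell k p) (s : seq nat) : uniq s ->
  \sum_(i <- s) modulus (x i) `^ p <= ell_norm x `^ p.
Proof. by move=> us; rewrite -lee_fin ell_norm_powR ell_sum_ge. Qed.

Lemma ell_norm_powR_le (x : ell k p) (C : R) :
  (forall N, \sum_(i <- iota 0 N) modulus (x i) `^ p <= C) -> ell_norm x `^ p <= C.
Proof. by move=> H; rewrite -lee_fin ell_norm_powR ell_sum_le. Qed.

Lemma ell_norm_le (x : ell k p) (C : R) : 0 <= C ->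
  (forall N, \sum_(i <- iota 0 N) modulus (x i) `^ p <= C `^ p) -> ell_norm x <= C.
Proof.
move=> C0 /ell_norm_powR_le H.
rewrite -(powR_invK p_gt0 (ell_norm_ge0 x)) -(powR_invK p_gt0 C0).
by apply: ge0_ler_powR; rewrite ?nnegrE ?powR_ge0// invr_ge0 ltW.
Qed.

Lemma ell_coordD (x y : ell k p) i : (x + y) i = x i + y i. Proof. by []. Qed.
Lemma ell_coordZ (a : K) (x : ell k p) i : (a *: x) i = a * x i. Proof. by []. Qed.
Lemma ell_coordB (x y : ell k p) i : (x - y) i = x i - y i. Proof. by []. Qed.

Lemma ell_coord_sum (I : Type) (s : seq I) (P : pred I) (F : I -> ell k p) i :
  (\sum_(j <- s | P j) F j) i = \sum_(j <- s | P j) F j i.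
Proof. by elim/big_ind2 : _ => // x a y b <- <-. Qed.

Lemma ell_ext (x y : ell k p) : (forall i, x i = y i) -> x = y.
Proof. by move=> H; apply/val_inj/funext. Qed.

Definition restrict_seq (s : seq nat) (f : nat -> K) (i : nat) : K :=
  if i \in s then f i else 0.

Lemma restrict_seq_sum s f N : uniq s ->
  \sum_(i <- iota 0 N) modulus (restrict_seq s f i) `^ p <= \sum_(i <- s) modulus (f i) `^ p.
Proof.
move=> us; rewrite (bigID (mem s))/= [X in _ + X]big1 ?addr0; last first.
  by move=> i /negbTE si; rewrite /restrict_seq si modulus0 powR0// gt_eqF.
rewrite (eq_bigr (fun i => modulus (f i) `^ p)); last first.
  by move=> i si; rewrite /restrict_seq si.
rewrite -big_filter; apply: ler_sum_sub => [i||i]; rewrite ?powR_ge0//.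
  by rewrite seq.filter_uniq// iota_uniq.
by rewrite mem_filter => /andP[].
Qed.

Lemma restrict_seq_ell s f : restrict_seq (undup s) f \in @ell_pred R k p.
Proof.
apply/ell_predP; apply: le_lt_trans (ell_sum_le _) (ltry _).
by move=> N; apply: restrict_seq_sum; rewrite undup_uniq.
Qed.

(** [undup] makes any list admissible as a support: the norm estimate requires a list without
    repetition. *)
Definition ell_fin s f : ell k p := Ell (restrict_seq_ell s f).

Lemma ell_finE s f i : ell_fin s f i = if i \in s then f i else 0.
Proof. by rewrite /= /restrict_seq mem_undup. Qed.

Lemma ell_fin_norm s f : uniq s ->
  ell_norm (ell_fin s f) `^ p <= \sum_(i <- s) modulus (f i) `^ p.
Proof.
move=> us; apply: ell_norm_powR_le => N /=.
by rewrite (undup_id us) restrict_seq_sum.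
Qed.

Lemma ell_fin_norm1 j : ell_norm (ell_fin [:: j] (fun=> 1)) <= 1.
Proof.
apply: ell_norm_le => // N.
by apply: le_trans (restrict_seq_sum _ _ _) _; rewrite //= big_seq1 modulus1.
Qed.

End ell_finite.

Section operators.
Context {R : realType} {k : scalar_kind}.
Local Notation K := (scalar_field R k).
Local Notation modulus := (@modulus R k).

(** All concrete operators are obtained from this criterion: homogeneity extends the bound from the
    unit ball, and bounds on partial sums give membership in the target space. *)
Lemma blin_of_bound (p s : exponent R) (phi : ell k p -> nat -> K) (C : R) :
  (forall a x y i, phi (a *: x + y) i = a * phi x i + phi y i) ->
  (forall x, ell_norm x <= 1 -> forall N, \sum_(i <- iota 0 N) modulus (phi x i) `^ s <= C) ->
  exists T : blinop (ell k p) (ell k s), forall x i, T x i = phi x i.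
Proof.
move=> lphi bphi; have s0 := exponent_gt0 s.
have phi0 i : phi 0 i = 0.
  have := lphi 1 0 0 i; rewrite scale1r addr0 mul1r => /eqP.
  by rewrite -subr_eq0 opprD addNKr oppr_eq0 => /eqP.
have phiZ a x i : phi (a *: x) i = a * phi x i.
  by have := lphi a x 0 i; rewrite addr0 phi0 addr0.
have C0 : 0 <= C.
  have := bphi 0 _ 0%N; rewrite big_nil; apply.
  by apply: ell_norm_le => // N; rewrite big1 ?powR1// => i _; rewrite modulus0 powR0// gt_eqF ?exponent_gt0.
have H x N : \sum_(i <- iota 0 N) modulus (phi x i) `^ s <= C * ell_norm x `^ s.
  have [/ell_norm_eq0 ->|x0] := eqVneq (ell_norm x) 0.
    by rewrite big1 ?mulr_ge0 ?powR_ge0// => i _; rewrite phi0 modulus0 powR0// gt_eqF.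
  have n0 : 0 < ell_norm x by rewrite lt_neqAle eq_sym x0 ell_norm_ge0.
  have c0 : of_real k (ell_norm x) != 0.
    by apply: contra x0 => /eqP; rewrite -(@of_real0 R k) => /of_real_inj ->.
  pose y := (of_real k (ell_norm x))^-1 *: x.
  have xy : x = of_real k (ell_norm x) *: y by rewrite /y scalerA mulfV// scale1r.
  have ny : ell_norm y <= 1.
    have := ell_normZ (of_real k (ell_norm x)) y; rewrite -xy modulus_of_real ger0_norm ?ell_norm_ge0//.
    by move=> /eqP; rewrite -{1}[ell_norm x]mulr1 -subr_eq0 -mulrBr mulf_eq0 (negbTE x0)/= subr_eq0 => /eqP <-.
  rewrite [in leLHS]xy; under eq_bigr do rewrite phiZ modulusM modulus_of_real ger0_norm ?ell_norm_ge0// powRM ?modulus_ge0 ?ell_norm_ge0//.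
  by rewrite -mulr_sumr mulrC ler_wpM2r ?powR_ge0// bphi.
have mem x : phi x \in @ell_pred R k s.
  by apply/ell_predP; apply: le_lt_trans (ell_sum_le (H x)) (ltry _).
pose f x : ell k s := Ell (mem x).
have lf : linear f by move=> a x y; apply: ell_ext => i; rewrite /f/= lphi.
have nf x : ell_norm (f x) <= C `^ (s : R)^-1 * ell_norm x.
  apply: ell_norm_le; first by rewrite mulr_ge0 ?powR_ge0 ?ell_norm_ge0.
  move=> N; rewrite powRM ?powR_ge0 ?ell_norm_ge0// -powRrM mulVf ?gt_eqF// powRr1//.
  exact: H.
pose L := GRing.isLinear.Build K (ell k p) (ell k s) *:%R f lf.
pose fL : {linear ell k p -> ell k s} := HB.pack f L.
have bf : f \in @blin_pred K (ell k p) (ell k s).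
  apply/blin_predP; split=> //; apply/(@linear_bounded_continuous _ _ _ fL)/linear_boundedP.
  near=> M => x; apply: (@le_trans _ _ (of_real k (C `^ (s : R)^-1) * `|x|)).
    by rewrite !ell_normE -of_realM ler_of_real nf.
  rewrite ler_wpM2r//; near: M; apply: nbhs_pinfty_ge.
  by apply: ger0_real; rewrite -(@of_real0 R k) ler_of_real powR_ge0.
by exists (Blinop bf).
Unshelve. all: by end_near. Qed.

End operators.

(** * Closed ideals generated by an operator *)

Section ideals.
Context {R : realType} {k : scalar_kind}.
Local Notation K := (scalar_field R k).

Lemma of_real_gt0 (e : R) : 0 < e -> 0 < of_real k e.
Proof.
move=> e0; rewrite lt_neqAle -{2}(@of_real0 R k) ler_of_real ltW// andbT.
by rewrite -(@of_real0 R k) (inj_eq (@of_real_inj R k)) lt_eqF.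
Qed.

Lemma lt_of_real (a b : R) : (of_real k a < of_real k b) = (a < b).
Proof. by rewrite !lt_neqAle ler_of_real (inj_eq (@of_real_inj R k)). Qed.

Lemma of_real_nat n : @of_real R k n%:R = n%:R.
Proof. by elim: n => [|n IH]; rewrite ?of_real0// -!natr1 of_realD IH of_real1. Qed.

Section two.
Variables X Y : normedModType K.
Implicit Types S T : blinop X Y.

Lemma ler_opnormD S T : opnorm (S + T) <= opnorm S + opnorm T.
Proof. by rewrite -(@ler_of_real R k) of_realD -!opnormE ler_normD. Qed.

Lemma opnormZ (a : K) T : opnorm (a *: T) = modulus a * opnorm T.
Proof. by apply: (@of_real_inj R k); rewrite of_realM -!opnormE normrZ of_real_modulus. Qed.

Lemma closure_opnormP (A : set (blinop X Y)) S :
  closure A S <-> forall e : R, 0 < e -> exists2 T, A T & opnorm (S - T) < e.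
Proof.
split=> [AS e e0|H B /nbhs_ballP[e /= e0 SB]].
  have [T [AT]] := AS _ (nbhsx_ballx S _ (of_real_gt0 e0)).
  by rewrite -ball_normE/= opnormE lt_of_real => ST; exists T.
(* The radius of a ball lies in [K]; being positive, it is real also in the complex case. *)
have eE : of_real k (modulus e) = e by rewrite of_real_modulus gtr0_norm.
have me0 : 0 < modulus e by rewrite -lt_of_real eE of_real0.
have [T AT ST] := H _ me0; exists T; split => //; apply: SB.
by rewrite -ball_normE/= opnormE -eE lt_of_real.
Qed.

Lemma blinBE S T x : (S - T) x = S x - T x. Proof. by []. Qed.

Lemma blin_sumE (I : Type) (s : seq I) (P : pred I) (F : I -> blinop X Y) x :
  (\sum_(j <- s | P j) F j) x = \sum_(j <- s | P j) F j x.
Proof. by elim/big_ind2 : _ => // S y T z <- <-. Qed.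

Lemma blin_map_sum (I : Type) (s : seq I) (P : pred I) (F : I -> X) T :
  T (\sum_(j <- s | P j) F j) = \sum_(j <- s | P j) T (F j).
Proof. exact: raddf_sum. Qed.

Lemma blin_mapB T x y : T (x - y) = T x - T y. Proof. exact: raddfB. Qed.

Lemma blin_mapZ T a x : T (a *: x) = a *: T x. Proof. exact: linearZ. Qed.

Lemma blin_ext S T : (forall x, S x = T x) -> S = T.
Proof. by move=> H; apply/val_inj/funext. Qed.

End two.

Lemma opnorm_comp (X Y Z : normedModType K) (S : blinop Y Z) (T : blinop X Y) :
  opnorm (blin_comp S T) <= opnorm S * opnorm T.
Proof.
apply: opnorm_le; first by rewrite mulr_ge0 ?opnorm_ge0.
move=> x /=; apply: le_trans (ler_opnorm _ _) _.
by rewrite of_realM -mulrA ler_wpM2l ?ler_opnorm// -(@of_real0 R k) ler_of_real opnorm_ge0.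
Qed.

Section through.
Variables X Y U V : normedModType K.
Implicit Types T : blinop U V.

Definition factor_sums T : set (blinop X Y) :=
  [set S | exists n (A : 'I_n -> blinop V Y) (B : 'I_n -> blinop X U),
    S = \sum_(i < n) blin_comp (A i) (blin_comp T (B i))].

(** Lists of pairs replace families indexed by ordinals, so that adding two sums is
    concatenation. *)
Lemma factor_sums_seq T (s : seq (blinop V Y * blinop X U)) :
  factor_sums T (\sum_(c <- s) blin_comp c.1 (blin_comp T c.2)).
Proof.
exists (size s), (fun i => (nth (0, 0) s i).1), (fun i => (nth (0, 0) s i).2).
by rewrite (big_nth (0, 0)) big_mkord.
Qed.

Lemma factor_sumsP T S : factor_sums T S ->
  exists s : seq (blinop V Y * blinop X U), S = \sum_(c <- s) blin_comp c.1 (blin_comp T c.2).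
Proof.
move=> [n [A [B ->]]]; exists [seq (A i, B i) | i <- index_enum 'I_n].
by rewrite big_map.
Qed.

Lemma ideal_through_closed_ideal T : is_closed_ideal (@ideal_through R k X Y U V T).
Proof.
split; last exact: closed_closure.
split.
- apply/subset_closure; have := factor_sums_seq T [::]; by rewrite big_nil.
- move=> a S1 S2 /closure_opnormP H1 /closure_opnormP H2; apply/closure_opnormP => e e0.
  (* The added 1 keeps the denominator positive when [a] is zero. *)
  have m1 : 0 < modulus a + 1 by rewrite ltr_wpDl ?modulus_ge0.
  have [T1 /factor_sumsP[s1 T1E] e1] := H1 (e / 2 / (modulus a + 1)) ltac:(by rewrite !divr_gt0).
  have [T2 /factor_sumsP[s2 T2E] e2] := H2 (e / 2) ltac:(by rewrite divr_gt0).
  exists (a *: T1 + T2).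
    have := factor_sums_seq T ([seq (a *: c.1, c.2) | c <- s1] ++ s2).
    rewrite big_cat big_map/= -T2E; congr (factor_sums _ (_ + _)).
    rewrite T1E scaler_sumr; apply: eq_bigr => c _; exact: blin_ext.
  have -> : a *: S1 + S2 - (a *: T1 + T2) = a *: (S1 - T1) + (S2 - T2).
    by rewrite scalerBr opprD addrACA.
  apply: le_lt_trans (ler_opnormD _ _) _; rewrite opnormZ.
  rewrite [ltRHS](splitr e); apply: ler_ltD => //.
  move: e1; rewrite ltr_pdivlMr// => /ltW e1; apply: le_trans e1.
  by rewrite mulrC ler_wpM2l ?opnorm_ge0// lerDl.
- move=> A S B /closure_opnormP H; apply/closure_opnormP => e e0.
  have c0 : 0 < opnorm A * opnorm B + 1 by rewrite ltr_wpDl ?mulr_ge0 ?opnorm_ge0.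
  have [T1 /factor_sumsP[s1 T1E] e1] := H (e / (opnorm A * opnorm B + 1)) (divr_gt0 e0 c0).
  exists (blin_comp A (blin_comp T1 B)).
    have := factor_sums_seq T [seq (blin_comp A c.1, blin_comp c.2 B) | c <- s1].
    rewrite big_map; congr (factor_sums _ _); apply: blin_ext => x.
    by rewrite T1E /= blin_sumE /= blin_sumE raddf_sum.
  have -> : blin_comp A (blin_comp S B) - blin_comp A (blin_comp T1 B) =
     blin_comp A (blin_comp (S - T1) B).
    by apply: blin_ext => x; rewrite blinBE /= raddfB.
  apply: le_lt_trans (opnorm_comp _ _) _.
  apply: (@le_lt_trans _ _ (opnorm A * (opnorm (S - T1) * opnorm B))).
    by rewrite ler_wpM2l ?opnorm_ge0 ?opnorm_comp.
  move: e1; rewrite ltr_pdivlMr//; apply: le_lt_trans.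
  rewrite mulrCA mulrDr mulr1 lerDl opnorm_ge0//.
Qed.

(** The factors [A] and [B] are absorbed by the outer operators. Every inclusion between the ideals
    of the theorem is obtained in this way. *)
Lemma ideal_through_incl (U' V' : normedModType K) T (T' : blinop U' V')
    (A : blinop V' V) (B : blinop U U') : T = blin_comp A (blin_comp T' B) ->
  @ideal_through R k X Y U V T `<=` @ideal_through R k X Y U' V' T'.
Proof.
move=> TE; apply: closure_subset => _ [n [C [D ->]]].
exists n, (fun i => blin_comp (C i) A), (fun i => blin_comp B (D i)).
by apply: eq_bigr => i _; rewrite TE; exact: blin_ext.
Qed.

End through.

Lemma ell_norm_blin (p q : exponent R) (T : blinop (ell k p) (ell k q)) x :
  ell_norm (T x) <= opnorm T * ell_norm x.
Proof. by rewrite -(@ler_of_real R k) of_realM -!ell_normE; exact: ler_opnorm. Qed.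

End ideals.

(** * Summation over lines *)

Section line_operator.
Context {R : realType} (k : scalar_kind) (p : exponent R) (d r : nat -> nat).
Context (p_gt1 : 1 < (p : R)) (p_lt2 : (p : R) < 2).
Local Notation K := (scalar_field R k).
Local Notation modulus := (@modulus R k).
Local Notation points := (points d r).

Definition conj_exp : R := (p : R) / ((p : R) - 1).
Local Notation pc := conj_exp.

Lemma conj_exp_gt2 : 2 < pc.
Proof. have h : 0 < (p : R) - 1 by rewrite subr_gt0. by rewrite /conj_exp ltr_pdivlMr//; move: p_lt2; lra. Qed.

Lemma conj_exp_gt0 : 0 < pc.
Proof. by apply: lt_trans conj_exp_gt2. Qed.

Lemma conj_expE : (p : R)^-1 + pc^-1 = 1.
Proof.
have p0 := exponent_gt0 p.
by rewrite /conj_exp invf_div mulrBl mulfV ?gt_eqF// mul1r addrC subrK.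
Qed.

Local Notation weight := (@weight R r pc).

(** Moduli inside the sum give one majorant of the coordinates of $T_M x$ for all $M$ at once. *)
Definition line_sum (x : nat -> K) (i : nat) : R :=
  weight i * \sum_(u <- points i) modulus (x u).

Lemma line_sum_ge0 x i : 0 <= line_sum x i.
Proof. by rewrite mulr_ge0 ?weight_ge0// sumr_ge0// => u _; apply: modulus_ge0. Qed.

Definition lines_through (s : seq nat) : seq nat := undup (flatten [seq points i | i <- s]).

Lemma line_sum_pairing (s : seq nat) (c : nat -> R) (x : nat -> K) :
  \sum_(i <- s) c i * line_sum x i = \sum_(u <- lines_through s)
    modulus (x u) * \sum_(i <- s | u \in points i) weight i * c i.
Proof.
under [RHS]eq_bigr do rewrite mulr_sumr.
rewrite [RHS](exchange_big_dep predT)//= big_seq [RHS]big_seq; apply: eq_bigr => i si.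
rewrite -big_filter (perm_big (points i)); last first.
  apply: uniq_perm; rewrite ?seq.filter_uniq ?undup_uniq ?uniq_points// => u.
  rewrite mem_filter mem_undup; apply/andP/idP => [[]//|ui]; split => //.
  by apply/flatten_mapP; exists i.
by rewrite /line_sum mulrCA mulrA mulrC mulr_suml; apply: eq_bigr => u _; rewrite mulrC; ring.
Qed.

(** The pairing is moved to the points by exchanging the sums, and Young's inequality is applied at
    each point. *)
Lemma line_sum_young (s : seq nat) (c : nat -> R) (x : ell k p) : (forall i, 0 <= c i) ->
  \sum_(i <- s) c i * line_sum x i <= ell_norm x `^ p +
    \sum_(u <- lines_through s) (\sum_(i <- s | u \in points i) weight i * c i) `^ pc.
Proof.
move=> c0; rewrite line_sum_pairing.
apply: le_trans (lerD (ell_norm_powR_ge x (undup_uniq (flatten [seq points i | i <- s]))) (lexx _)).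
rewrite -big_split/=; apply: ler_sum => u _.
apply: young_crude; rewrite ?modulus_ge0 ?exponent_gt0 ?conj_exp_gt0 ?conj_expE//.
by apply: sumr_ge0 => i _; rewrite mulr_ge0 ?weight_ge0.
Qed.

(** The inequality [line_sum_young] is applied to $\lambda x$ and divided by $\lambda$; a large
    $\lambda$ makes the contribution of [size s] small. *)
Lemma line_sum_few (s : seq nat) (x : ell k p) (lam : R) : 0 < lam -> uniq s ->
  (forall i, i \in s -> (d (block i))%:R `^ pc * (size s)%:R <= (r (block i))%:R :> R) ->
  \sum_(i <- s) line_sum x i <= lam^-1 * (2 * (size s)%:R + lam `^ p * ell_norm x `^ p).
Proof.
move=> l0 us H.
have lZ i : line_sum (of_real k lam *: x) i = lam * line_sum x i.
  rewrite /line_sum mulrCA; congr (_ * _); rewrite mulr_sumr; apply: eq_bigr => u _.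
  by rewrite modulusM modulus_of_real gtr0_norm.
rewrite ler_pdivlMl//  mulr_sumr.
have := @line_sum_young s (fun=> 1) (of_real k lam *: x) (fun=> ler01).
rewrite ell_normZ modulus_of_real gtr0_norm// powRM ?ell_norm_ge0 ?(ltW l0)// addrC.
under eq_bigr do rewrite mul1r lZ.
move=> /le_trans; apply; rewrite lerD2r.
under eq_bigr do under eq_bigr do rewrite mulr1.
by apply: weight_sum_few; rewrite ?conj_exp_gt2// undup_uniq.
Qed.

(* By duality: [a] is the normalized sequence of line sums, [t n] the threshold between large and
   small coefficients in block [n]. *)
Lemma line_sum_sqr (t : nat -> R) (s : seq nat) (x : ell k p) : (forall n, 0 < t n) ->
  (forall n, (d n)%:R `^ pc * t n `^ (pc - 2) <= 1) ->
  (forall n, (d n)%:R `^ pc * t n ^- 4 <= (r n)%:R) -> uniq s -> ell_norm x <= 1 ->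
  \sum_(i <- s) line_sum x i ^+ 2 <= (1 + 2 `^ pc * 3) ^+ 2.
Proof.
move=> t0 dt rt us x1.
set V := \sum_(i <- s) _.
have V0 : 0 <= V by apply: sumr_ge0 => i _; rewrite sqr_ge0.
have [->|Vn0] := eqVneq V 0; first by rewrite sqr_ge0.
have vp : 0 < Num.sqrt V by rewrite sqrtr_gt0 lt_neqAle eq_sym Vn0.
rewrite -[leLHS](sqr_sqrtr V0) lerXn2r ?nnegrE ?sqrtr_ge0//.
pose a i := if i \in s then line_sum x i / Num.sqrt V else 0.
have a0 i : 0 <= a i by rewrite /a; case: ifP => // _; rewrite divr_ge0 ?line_sum_ge0 ?sqrtr_ge0.
have a1 i : a i <= 1.
  rewrite /a; case: ifP => // si; rewrite ler_pdivrMr// mul1r.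
  rewrite -ler_sqr ?nnegrE ?line_sum_ge0 ?sqrtr_ge0// sqr_sqrtr//.
  by rewrite /V (bigD1_seq i)//= lerDl sumr_ge0// => j _; rewrite sqr_ge0.
have a2 : \sum_(i <- s) a i ^+ 2 = 1.
  rewrite big_seq (eq_bigr (fun i => (line_sum x i ^+ 2) / V)); last first.
    by move=> i si; rewrite /a si expr_div_n sqr_sqrtr.
  by rewrite -big_seq -mulr_suml mulfV.
have -> : Num.sqrt V = \sum_(i <- s) a i * line_sum x i.
  rewrite big_seq (eq_bigr (fun i => (line_sum x i ^+ 2) / Num.sqrt V)); last first.
    by move=> i si; rewrite /a si mulrAC.
  rewrite -big_seq -mulr_suml -/V -{2}(sqr_sqrtr V0) expr2 mulfK// gt_eqF//.
apply: le_trans (line_sum_young _ _ a0) _; apply: lerD.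
  by rewrite powR_le1 ?ell_norm_ge0 ?x1// ltW// exponent_gt0.
apply: (@weight_sum_small R d r pc conj_exp_gt2 s _ a t) => //.
- by rewrite undup_uniq.
- by move=> i; rewrite a0 a1.
- by rewrite a2.
Qed.

Lemma line_operator_exists (M : nat -> bool) (t : nat -> R) : (forall n, 0 < t n) ->
  (forall n, (d n)%:R `^ pc * t n `^ (pc - 2) <= 1) ->
  (forall n, (d n)%:R `^ pc * t n ^- 4 <= (r n)%:R) ->
  exists T : blinop (ell k p) (ell k (exponent2 R)), forall x i,
    T x i = if M (block i) then of_real k (weight i) * \sum_(u <- points i) x u else 0.
Proof.
move=> t0 dt rt.
apply: (@blin_of_bound R k p (exponent2 R) (fun x i => if M (block i) then
   of_real k (weight i) * \sum_(u <- points i) x u else 0) ((1 + 2 `^ pc * 3) ^+ 2)).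
  move=> a x y i; case: ifP => _; last by rewrite mulr0 addr0.
  rewrite big_split/= mulrDr -mulr_sumr; congr (_ + _); ring.
move=> x x1 N; apply: le_trans (line_sum_sqr t0 dt rt (iota_uniq 0 N) x1).
apply: ler_sum => i _; rewrite powR_mulrn ?modulus_ge0// lerXn2r ?nnegrE ?line_sum_ge0 ?modulus_ge0//.
case: ifP => _; last by rewrite modulus0 line_sum_ge0.
rewrite modulusM modulus_of_real ger0_norm ?weight_ge0// ler_wpM2l ?weight_ge0//.
exact: modulus_sum.
Qed.

End line_operator.

(** * Random signs *)

Section rademacher.
Context (N : nat).
Local Notation signs := {ffun 'I_N.+1 -> bool}.

(** Lines are coded by natural numbers, hence the coercion by [inord]; only indices up to [N] have
    signs of their own. *)
Definition sgn {A : pzRingType} (e : signs) (i : nat) : A := (-1) ^+ e (inord i).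

Lemma sgn_orthogonal (A : comNzRingType) (i j : nat) : (i <= N)%N -> (j <= N)%N -> i != j ->
  \sum_(e : signs) sgn e i * sgn e j = 0 :> A.
Proof.
move=> iN jN ij.
pose i' : 'I_N.+1 := inord i; pose j' : 'I_N.+1 := inord j.
have ij' : j' != i'.
  by apply: contra ij => /eqP /(congr1 val) /=; rewrite !inordK// => ->.
rewrite (bigID (fun e : signs => e i'))/=.
(* Flipping the sign at [i] is an involution that changes the sign of the product. *)
pose flip (e : signs) : signs := [ffun x => e x (+) (x == i')].
have flipK : involutive flip.
  by move=> e; apply/ffunP => x; rewrite !ffunE addbK.
rewrite (reindex_inj (inv_inj flipK))/=.
rewrite [X in X + _](eq_big (fun e : signs => ~~ e i') (fun e => - (sgn e i * sgn e j))); first last.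
- move=> e _; rewrite /sgn !ffunE -/i' -/j' eqxx (negbTE ij') addbF addbT signrN mulNr//.
- by move=> e; rewrite ffunE eqxx addbT.
by rewrite sumrN addNr.
Qed.

(** By orthogonality only the diagonal survives. *)
Lemma sgn_average (A : comNzRingType) (s : seq nat) (b : nat -> nat -> A) :
  uniq s -> (forall i, i \in s -> (i <= N)%N) ->
  \sum_(e : signs) \sum_(i <- s) \sum_(j <- s) sgn e i * sgn e j * b i j =
  #|{: signs}|%:R * \sum_(i <- s) b i i.
Proof.
move=> us sN; rewrite exchange_big mulr_sumr big_seq [RHS]big_seq; apply: eq_bigr => i si.
rewrite exchange_big (bigD1_seq i)//= [X in _ + X]big_seq_cond [X in _ + X]big1 ?addr0.
  rewrite (eq_bigr (fun=> b i i)); first by rewrite sumr_const mulr_natl.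
  by move=> e _; rewrite /sgn -expr2 sqrr_sign mul1r.
move=> j /andP[sj ji]; rewrite -mulr_suml sgn_orthogonal ?mul0r ?sN// eq_sym//.
Qed.

End rademacher.

(** * Random sums of normalized indicators of lines *)

Section block_vectors.
Context {R : realType} (k : scalar_kind) (p : exponent R) (d r : nat -> nat).
Context (p_le2 : (p : R) <= 2).
Local Notation K := (scalar_field R k).
Local Notation modulus := (@modulus R k).
Local Notation points := (points d r).
Let p_gt0 := exponent_gt0 p.

Lemma ell_norm_support (x : ell k p) (s : seq nat) : uniq s -> (forall i, i \notin s -> x i = 0) ->
  ell_norm x `^ p <= \sum_(i <- s) modulus (x i) `^ p.
Proof.
move=> us x0; have -> : ell_norm x = ell_norm (ell_fin p s x).
  by congr ell_norm; apply: ell_ext => i; rewrite ell_finE; case: ifP => // /negbT /x0.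
exact: ell_fin_norm.
Qed.

Definition line_vector (i : nat) : ell k p :=
  ell_fin p (points i) (fun=> of_real k ((r (block i))%:R `^ (- (p : R)^-1))).

Lemma line_vector_norm i : ell_norm (line_vector i) <= 1.
Proof.
apply: (@le_trans _ _ ((ell_norm (line_vector i) `^ p) `^ (p : R)^-1)).
  by rewrite powR_invK ?ell_norm_ge0.
apply: powR_le1; last by rewrite invr_ge0 ltW.
rewrite powR_ge0/=; apply: le_trans (ell_fin_norm _ _ (uniq_points d r i)) _.
rewrite big_const_seq iter_addr addr0 modulus_of_real ger0_norm ?powR_ge0//.
rewrite -powRrM mulNr mulVf ?gt_eqF// powR_inv1// count_predT -[_ *+ _]mulr_natl.
have [r0|r0] := posnP (r (block i)); first by rewrite r0 invr0 mulr0.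
by rewrite ler_pdivrMr ?ltr0n// mul1r ler_nat size_points_le.
Qed.

(** For $w=z/\lambda$ this is $w^p\le1+w^2$, true as $p\le2$. It reduces $p$-th moments to second
    moments, with $\lambda$ the expected size of $z$. *)
Lemma powR_le_sqr (z lam : R) : 0 <= z -> 0 < lam ->
  z `^ p <= lam `^ p * (1 + z ^+ 2 / lam ^+ 2).
Proof.
move=> z0 l0; have l0' := ltW l0.
have -> : z = lam * (z / lam) by rewrite mulrC divfK// gt_eqF.
have w0 : 0 <= z / lam by rewrite divr_ge0.
rewrite [in leLHS]powRM// ler_wpM2l ?powR_ge0//.
rewrite [in leRHS]exprMn mulrAC mulfV ?mul1r ?expf_neq0 ?gt_eqF//.
have [w1|w1] := leP (z / lam) 1.
  by apply: (@le_trans _ _ 1); [rewrite powR_le1 ?w0// ltW|rewrite lerDl sqr_ge0].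
apply: (@le_trans _ _ ((z / lam) ^+ 2)); last by rewrite lerDr.
by rewrite -powR_mulrn// ler_powR// ltW.
Qed.

(** At each point at most $d$ signs are added, so the second moment is at most $d$ and, with
    $\lambda=\sqrt d$, the $p$-th moment is at most $2d^{p/2}$. The $2dr^2$ points, each with the
    factor $1/r$, give $4dr\,d^{p/2}$. *)
Lemma random_block_norm (n N : nat) : (forall i, i \in block_lines d r n -> (i <= N)%N) ->
  (0 < d n)%N -> (0 < r n)%N ->
  \sum_(e : {ffun 'I_N.+1 -> bool})
     ell_norm (\sum_(i <- block_lines d r n) sgn e i *: line_vector i) `^ p <=
  #|{: {ffun 'I_N.+1 -> bool}}|%:R * (4 * (d n * r n)%:R * Num.sqrt (d n)%:R `^ p).
Proof.
move=> LN d0 r0; set L := block_lines d r n; set P := block_points d r n.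
have uL : uniq L := uniq_block_lines d r n.
have dn0 : 0 < (d n)%:R :> R by rewrite ltr0n.
have rn0 : 0 < (r n)%:R :> R by rewrite ltr0n.
set lam := Num.sqrt (d n)%:R; have l0 : 0 < lam by rewrite sqrtr_gt0.
pose z (e : {ffun 'I_N.+1 -> bool}) u : R := \sum_(i <- L | u \in points i) sgn e i.
have coordE e u : (\sum_(i <- L) sgn e i *: line_vector i) u =
   of_real k ((r n)%:R `^ (- (p : R)^-1) * z e u).
  rewrite ell_coord_sum /z mulr_sumr raddf_sum [RHS]big_mkcond.
  rewrite big_seq [RHS]big_seq; apply: eq_bigr => i iL.
  rewrite ell_coordZ ell_finE; case: ifP => _; last by rewrite mulr0.
  by rewrite (block_lines_block iL) [RHS]/= of_realM mulrC; congr (_ * _); rewrite /sgn rmorph_sign.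
have H e : ell_norm (\sum_(i <- L) sgn e i *: line_vector i) `^ p <=
    \sum_(u <- P) (r n)%:R^-1 * (lam `^ p * (1 + z e u ^+ 2 / lam ^+ 2)).
  apply: le_trans (ell_norm_support (uniq_block_points d r n) _) _.
    move=> u uP; rewrite coordE /z big_seq_cond big1 ?mulr0 ?of_real0//.
    move=> i /andP[iL ui]; move: uP; by rewrite (points_sub iL ui).
  apply: ler_sum => u _; rewrite coordE modulus_of_real normrM ger0_norm ?powR_ge0//.
  rewrite powRM ?powR_ge0// -powRrM mulNr mulVf ?gt_eqF// powR_inv1 ?ler0n//.
  rewrite ler_wpM2l ?invr_ge0 ?ler0n//.
  by apply: le_trans (powR_le_sqr (normr_ge0 _) l0) _; rewrite real_normK ?num_real.
apply: le_trans (ler_sum _ (fun e _ => H e)) _.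
rewrite exchange_big/=.
apply: (@le_trans _ _ (\sum_(u <- P) #|{: {ffun 'I_N.+1 -> bool}}|%:R * ((r n)%:R^-1 * (lam `^ p * 2)))).
  apply: ler_sum => u _; rewrite -mulr_sumr mulrCA ler_wpM2l ?invr_ge0 ?ler0n//.
  rewrite -mulr_sumr mulrCA ler_wpM2l ?powR_ge0// big_split/= sumr_const mulr_natr mulr2n lerD2l.
  have -> : \sum_e z e u ^+ 2 / lam ^+ 2 = (\sum_e z e u ^+ 2) / (d n)%:R.
    by rewrite mulr_suml /lam sqr_sqrtr ?(ltW dn0).
  rewrite ler_pdivrMr//.
  rewrite (eq_bigr (fun e => \sum_(i <- [seq i <- L | u \in points i]) \sum_(j <- [seq i <- L | u \in points i])
     sgn e i * sgn e j * 1)); last first.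
    move=> e _; rewrite /z -big_filter expr2 mulr_suml; apply: eq_bigr => i _.
    by rewrite mulr_sumr; apply: eq_bigr => j _; rewrite mulr1.
  rewrite sgn_average ?seq.filter_uniq//; last first.
    by move=> i; rewrite mem_filter => /andP[_ /LN].
  rewrite big_const_seq iter_addr addr0 count_predT ler_wpM2l ?ler0n//.
  rewrite ler_nat size_filter.
  have [|/hasPn h0] := boolP (has (fun i => u \in points i) L).
    move=> /hasP[i iL ui]; apply: leq_trans (count_lines d r u uL) _.
    by rewrite (block_point ui) (block_lines_block iL).
  by rewrite (eq_in_count (a2 := pred0)) ?count_pred0// => i /h0 /negbTE ->.
rewrite big_const_seq iter_addr addr0 count_predT /P size_block_points -[_ *+ _]mulr_natr.
rewrite -mulrA ler_wpM2l ?ler0n//.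
rewrite le_eqVlt; apply/orP; left; apply/eqP.
rewrite !natrM; field; exact: lt0r_neq0.
Qed.

End block_vectors.

(** * The trace on one block *)

Section coordinates.
Context {R : realType} {k : scalar_kind}.
Local Notation K := (scalar_field R k).
Local Notation modulus := (@modulus R k).

Definition unit_vector (p : exponent R) (j : nat) : ell k p := ell_fin p [:: j] (fun=> 1).

Lemma unit_vectorE p j i : unit_vector p j i = (i == j)%:R.
Proof. by rewrite ell_finE inE; case: eqP. Qed.

(** Chebyshev's inequality for the counting measure. *)
Lemma count_large (p : exponent R) (x : ell k p) (rho : R) (s : seq nat) :
  0 <= rho -> uniq s ->
  (count (fun j => rho <= modulus (x j)) s)%:R * rho `^ p <= ell_norm x `^ p.
Proof.
move=> rho0 us; apply: le_trans (ell_norm_powR_ge x us).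
rewrite mulrC mulr_natr -iter_addr_0 -big_const_seq big_mkcond/=; apply: ler_sum => j _.
case: ifP => [h|_]; last by rewrite powR_ge0.
by apply: ge0_ler_powR; rewrite ?nnegrE ?modulus_ge0// ltW// exponent_gt0.
Qed.

(** The number of large coordinates among the first [n] is bounded, hence attains its maximum at
    some [N], after which no large coordinate occurs. *)
Lemma ell_tail (p : exponent R) (x : ell k p) (rho : R) : 0 < rho ->
  exists N, forall j, (N <= j)%N -> modulus (x j) < rho.
Proof.
move=> rho0; have rp : 0 < rho `^ p by apply: powR_gt0.
pose c n := count (fun j => rho <= modulus (x j)) (iota 0 n).
have [D cD] : exists D, forall n, (c n <= D)%N.
  exists (Num.truncn (ell_norm x `^ p / rho `^ p)) => n.
  rewrite truncn_ge_nat ?divr_ge0 ?powR_ge0// ler_pdivlMr//.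
  by apply: count_large; rewrite ?iota_uniq// ltW.
pose P m := `[< exists n, c n = m >].
have exP : exists m, P m by exists (c 0%N); apply/asboolP; exists 0%N.
have bP m : P m -> (m <= D)%N by move=> /asboolP[n <-].
have [m /asboolP[N cN] Nmax] := ex_maxnP exP bP.
exists N => j Nj; rewrite ltNge; apply/negP => h.
have /Nmax : P (c j.+1) by apply/asboolP; exists j.+1.
rewrite -cN /c -addn1 iotaD count_cat add0n/= h addn0 -(subnKC Nj) iotaD count_cat.
lia.
Qed.

Context (q : exponent R) (q_gt2 : 2 < (q : R)).
Local Notation ell2 := (ell k (exponent2 R)).
Local Notation incl := (ell_incl k (exponent2 R) q q_gt2).

(** The remaining coordinates are smaller than $\rho$, hence satisfy $|y_j|^q\le\rho^{q-2}|y_j|^2$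
    because $q>2$: the remainder is small in $\ell_q$. *)
Lemma truncation_error (A : blinop (ell k q) (ell k q)) (y : ell2) (rho : R) N i :
  0 < rho -> (forall j, (N <= j)%N -> modulus (y j) < rho) ->
  modulus (A (incl y) i - \sum_(j <- iota 0 N | rho <= modulus (y j)) y j * A (unit_vector q j) i)
   <= opnorm A * (rho `^ ((q : R) - 2) * ell_norm y ^+ 2) `^ (q : R)^-1.
Proof.
move=> rho0 tail; have q0 := exponent_gt0 q.
pose z : ell k q := incl y - \sum_(j <- iota 0 N | rho <= modulus (y j)) y j *: unit_vector q j.
have -> : A (incl y) i - \sum_(j <- iota 0 N | rho <= modulus (y j)) y j * A (unit_vector q j) i = A z i.
  rewrite /z blin_mapB ell_coordB blin_map_sum ell_coord_sum; congr (_ - _).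
  by apply: eq_bigr => j _; rewrite blin_mapZ ell_coordZ.
have zE u : z u = if (u < N)%N && (rho <= modulus (y u)) then 0 else y u.
  rewrite /z ell_coordB ell_inclE ell_coord_sum.
  have -> : \sum_(j <- iota 0 N | rho <= modulus (y j)) (y j *: unit_vector q j) u =
     \sum_(j <- iota 0 N | j == u) if rho <= modulus (y u) then y u else 0.
    rewrite big_mkcond [RHS]big_mkcond/=; apply: eq_bigr => j _.
    rewrite -[X in if _ then X else _]/(y j * unit_vector q j u) unit_vectorE eq_sym.
    by have [->|] := eqVneq j u; case: ifP => //; rewrite ?mulr1 ?mulr0.
  rewrite big_const_seq iter_addr addr0 count_uniq_mem ?iota_uniq// mem_iota/= add0n.
  by case: (u < N)%N; case: ifP; rewrite ?mulr0n ?mulr1n ?subrr ?subr0.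
clearbody z.
apply: le_trans (ell_norm_coord _ _) _; apply: le_trans (ell_norm_blin _ _) _.
rewrite ler_wpM2l ?opnorm_ge0//.
rewrite -{1}(powR_invK q0 (ell_norm_ge0 z)).
have yge0 : 0 <= rho `^ ((q : R) - 2) * ell_norm y ^+ 2 by rewrite mulr_ge0 ?powR_ge0 ?sqr_ge0.
apply: ge0_ler_powR; rewrite ?nnegrE ?powR_ge0 ?invr_ge0 ?(ltW q0)//.
apply: ell_norm_powR_le => n.
have := ell_norm_powR_ge y (iota_uniq 0 n); rewrite powR_mulrn ?ell_norm_ge0//= => H.
apply: le_trans (ler_wpM2l (powR_ge0 rho ((q : R) - 2)) H).
rewrite mulr_sumr; apply: ler_sum => u _; rewrite zE powR_mulrn ?modulus_ge0//.
case: ifP => [_|/negbT]; first by rewrite modulus0 powR0 ?gt_eqF// mulr_ge0 ?powR_ge0 ?sqr_ge0.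
rewrite negb_and -leqNgt -ltNge => h.
have yr : modulus (y u) < rho by case/orP: h => // /tail.
have -> : modulus (y u) `^ q = modulus (y u) `^ ((q : R) - 2) * modulus (y u) ^+ 2.
  rewrite -powR_mulrn ?modulus_ge0// -powRD ?subrK//.
  by apply/implyP => /eqP; move: q_gt2; lra.
rewrite ler_wpM2r ?sqr_ge0//.
by apply: ge0_ler_powR; rewrite ?nnegrE ?modulus_ge0 ?subr_ge0 ?ltW.
Qed.

End coordinates.

(** * Averaged traces over the blocks outside $M$ *)

Section trace_estimate.
Context {R : realType} {k : scalar_kind} (p q : exponent R) (d r : nat -> nat).
Context (p_gt1 : 1 < (p : R)) (p_lt2 : (p : R) < 2) (q_gt2 : 2 < (q : R)).
Local Notation K := (scalar_field R k).
Local Notation modulus := (@modulus R k).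
Local Notation points := (points d r).
Local Notation pc := (conj_exp p).
Local Notation weight := (@weight R r pc).
Local Notation ell2 := (ell k (exponent2 R)).
Local Notation incl := (ell_incl k (exponent2 R) q q_gt2).
Local Notation lines := (block_lines d r).
Local Notation fvec := (line_vector k p d r).

Definition lines_below (n : nat) : nat := \sum_(i < n) d i ^ 2 * r i.

Context (d_gt0 : forall n, (0 < d n)%N) (r_gt0 : forall n, (0 < r n)%N).
Context (r_large : forall n, (d n)%:R `^ pc * (n * lines_below n)%:R <= (r n)%:R).
Context (M : nat -> bool) (T : blinop (ell k p) ell2).
Context (TE : forall x i, T x i =
  if M (block i) then of_real k (weight i) * \sum_(u <- points i) x u else 0).

Lemma modulus_T_le x i : modulus (T x i) <= line_sum p d r x i.
Proof.
rewrite TE; case: ifP => _; last by rewrite modulus0 line_sum_ge0.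
rewrite modulusM modulus_of_real ger0_norm ?weight_ge0// ler_wpM2l ?weight_ge0//.
exact: modulus_sum.
Qed.

Lemma modulus_sgn N (e : {ffun 'I_N.+1 -> bool}) i : modulus (sgn e i) = 1.
Proof. by rewrite /sgn; case: (e _); rewrite ?expr1 ?modulusN modulus1. Qed.

(* The left-hand side is the average over the signs [e] of a functional supported by the lines of
   [J], evaluated at the image under [B] of the sum of the [sgn e l *: fvec l]. *)
Lemma bilinear_bound (B : blinop (ell k p) (ell k p)) (n : nat) (J : seq nat)
    (c : nat -> nat -> K) (beta lam : R) : 0 < lam -> uniq J ->
  (forall j, \sum_(l <- lines n) modulus (c l j) <= beta) ->
  (forall j, j \in J -> (d (block j))%:R `^ pc * (size J)%:R <= (r (block j))%:R) ->
  modulus (\sum_(l <- lines n) \sum_(j <- J) c l j * T (B (fvec l)) j) <=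
  beta * (lam^-1 * (2 * (size J)%:R + (lam * opnorm B) `^ p *
     (4 * (d n * r n)%:R * Num.sqrt (d n)%:R `^ p))).
Proof.
move=> l0 uJ cb Jr; set L := lines n.
have beta0 : 0 <= beta by apply: le_trans (cb 0%N); apply: sumr_ge0 => l _; apply: modulus_ge0.
have B0 := opnorm_ge0 B.
pose N := \max_(l <- L) l.
have LN l : l \in L -> (l <= N)%N by move=> lL; apply: leq_bigmax_seq.
pose E := {ffun 'I_N.+1 -> bool}.
pose F (e : E) := \sum_(l <- L) sgn e l *: fvec l.
have E0 : 0 < #|E|%:R :> R by rewrite ltr0n; apply/card_gt0P; exists [ffun=> true].
(* Averaging over the signs decouples the coefficients from the vectors: only the terms with equal
   lines remain. *)
have avg : #|E|%:R * (\sum_(l <- L) \sum_(j <- J) c l j * T (B (fvec l)) j) =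
    \sum_(e : E) \sum_(j <- J) (\sum_(l <- L) sgn e l * c l j) * T (B (F e)) j.
  rewrite -(@sgn_average N K L (fun l l' => \sum_(j <- J) c l j * T (B (fvec l')) j))//; last exact: uniq_block_lines.
  apply: eq_bigr => e _; rewrite exchange_big/=.
  under eq_bigr do under eq_bigr do rewrite mulr_sumr.
  under eq_bigr do rewrite exchange_big/=.
  rewrite exchange_big/=; apply: eq_bigr => j _.
  rewrite /F !blin_map_sum ell_coord_sum mulr_sumr; apply: eq_bigr => l' _.
  rewrite !blin_mapZ ell_coordZ mulr_suml; apply: eq_bigr => l _; ring.
rewrite -(ler_pM2l E0).
have -> : #|E|%:R * modulus (\sum_(l <- L) \sum_(j <- J) c l j * T (B (fvec l)) j) =
   modulus (#|E|%:R * (\sum_(l <- L) \sum_(j <- J) c l j * T (B (fvec l)) j)).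
  rewrite modulusM; congr (_ * _); rewrite -(@of_real_nat R k).
  by rewrite modulus_of_real ger0_norm// ltW.
rewrite avg; apply: le_trans (modulus_sum _ _ _) _.
apply: (@le_trans _ _ (\sum_(e : E) beta * (lam^-1 * (2 * (size J)%:R + (lam * opnorm B) `^ p * ell_norm (F e) `^ p)))).
  apply: ler_sum => e _; apply: le_trans (modulus_sum _ _ _) _.
  apply: (@le_trans _ _ (\sum_(j <- J) beta * line_sum p d r (B (F e)) j)).
    apply: ler_sum => j _; rewrite modulusM ler_pM ?modulus_ge0 ?modulus_T_le//.
    apply: le_trans (modulus_sum _ _ _) _; apply: le_trans (cb j).
    by apply: ler_sum => l _; rewrite modulusM modulus_sgn mul1r.
  rewrite -mulr_sumr ler_wpM2l//.
  apply: le_trans (line_sum_few p_gt1 p_lt2 (B (F e)) l0 uJ Jr) _.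
  rewrite ler_wpM2l ?invr_ge0 ?(ltW l0)// lerD2l [in leRHS]powRM ?(ltW l0)//.
  rewrite -mulrA ler_wpM2l ?powR_ge0// -powRM ?ell_norm_ge0//.
  apply: ge0_ler_powR; rewrite ?nnegrE ?mulr_ge0 ?ell_norm_ge0 ?ell_norm_blin//.
  exact: ltW (exponent_gt0 p).
rewrite -mulr_sumr mulrCA ler_wpM2l// -mulr_sumr mulrCA ler_wpM2l ?invr_ge0 ?(ltW l0)//.
rewrite big_split [leRHS]mulrDr; apply: lerD; first by rewrite sumr_const -[leLHS]mulr_natl.
rewrite -mulr_sumr [leRHS]mulrCA ler_wpM2l ?powR_ge0//.
apply: random_block_norm => //; exact: ltW.
Qed.

Lemma lines_below_lt n m : (n < m)%N -> (d n ^ 2 * r n <= lines_below m)%N.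
Proof. by move=> nm; rewrite /lines_below (bigD1 (Ordinal nm))//= leq_addr. Qed.

Lemma T_support x j : T x j != 0 -> M (block j) && (j \in lines (block j)).
Proof.
rewrite TE; case: ifP => [_/=|_]; last by rewrite eqxx.
case E : (points j) => [|u l]; first by rewrite big_nil mulr0 eqxx.
by move=> _; apply: (@mem_block_lines d r j u); rewrite E inE eqxx.
Qed.

Lemma count_lines_below (s : seq nat) n : uniq s ->
  (forall j, j \in s -> (block j < n)%N && (j \in lines (block j))) -> (size s <= lines_below n)%N.
Proof.
move=> us sj.
have -> : lines_below n = size (flatten [seq lines i | i <- iota 0 n]).
  rewrite size_flatten /shape -map_comp sumnE big_map /lines_below -(big_mkord xpredT (fun i => d i ^ 2 * r i)%N).
  by rewrite /index_iota subn0; apply: eq_bigr => i _; rewrite /= size_block_lines.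
apply: uniq_leq_size => // j /sj /andP[jn jl].
by apply/flatten_mapP; exists (block j); rewrite ?mem_iota.
Qed.

(** Here $\rho$ is the threshold for the coordinates of $TBf_l$ and $\eta$ that for the entries of
    $A$. At most $(C_1/\rho)^2$ coordinates are large for each line, and at most $(\|A\|/\eta)^q$
    entries in each column of $A$. The terms on the right account for small coordinates, small
    entries, lower blocks and higher blocks; $\lambda$ remains free. *)
Lemma trace_bound (A : blinop (ell k q) (ell k q)) (B : blinop (ell k p) (ell k p))
    (n : nat) (rho eta lam C1 : R) : ~~ M n -> 0 < rho -> 0 < eta -> 0 < lam ->
  opnorm T * opnorm B <= C1 -> (C1 / rho) ^+ 2 <= n%:R ->
  modulus (\sum_(l <- lines n) A (incl (T (B (fvec l)))) l) <=
    (d n ^ 2 * r n)%:R * (opnorm A * (rho `^ ((q : R) - 2) * C1 ^+ 2) `^ (q : R)^-1 +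
                          (C1 / rho) ^+ 2 * (C1 * eta)) +
    (lines_below n)%:R * ((opnorm A / eta) `^ q * (C1 * opnorm A)) +
    ((opnorm A / eta) `^ q * opnorm A) * (lam^-1 * (2 * ((d n ^ 2 * r n)%:R * (C1 / rho) ^+ 2) +
       (lam * opnorm B) `^ p * (4 * (d n * r n)%:R * Num.sqrt (d n)%:R `^ p))).
Proof.
move=> Mn rho0 eta0 lam0 C1b D1n.
set L := lines n; set CA := opnorm A; set D1 := (C1 / rho) ^+ 2; set D2 := (CA / eta) `^ q.
have CA0 : 0 <= CA := opnorm_ge0 A.
have C10 : 0 <= C1 by apply: le_trans C1b; rewrite mulr_ge0 ?opnorm_ge0.
have q0 := exponent_gt0 q.
have uL : uniq L := uniq_block_lines d r n.
have sL : size L = (d n ^ 2 * r n)%N := size_block_lines d r n.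
pose y l := T (B (fvec l)).
have yC l : ell_norm (y l) <= C1.
  apply: le_trans (ell_norm_blin _ _) _; apply: le_trans C1b; rewrite ler_wpM2l ?opnorm_ge0//.
  apply: le_trans (ell_norm_blin _ _) _; rewrite -[leRHS]mulr1 ler_wpM2l ?opnorm_ge0//.
  exact: line_vector_norm.
have yjC l j : modulus (y l j) <= C1 by apply: le_trans (ell_norm_coord _ _) (yC l).
pose al l j : K := A (unit_vector q j) l.
have ajC j : ell_norm (A (unit_vector q j)) <= CA.
  apply: le_trans (ell_norm_blin _ _) _; rewrite -[leRHS]mulr1 ler_wpM2l ?opnorm_ge0//.
  exact: ell_fin_norm1.
have alC l j : modulus (al l j) <= CA by apply: le_trans (ell_norm_coord _ _) (ajC j).
have [N tail] : exists N, forall l j, l \in L -> (N <= j)%N -> modulus (y l j) < rho.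
  elim: (L) => [|l s [N1 H1]]; first by exists 0%N.
  have [N2 H2] := ell_tail (y l) rho0; exists (maxn N1 N2) => l' j.
  rewrite inE geq_max => /orP[/eqP ->|ls] /andP[j1 j2]; [exact: H2|exact: H1].
pose big l j := rho <= modulus (y l j).
pose E l j := big l j && (eta <= modulus (al l j)).
have cbig l s : uniq s -> (count (big l) s)%:R <= D1.
  move=> us; have := count_large (y l) (ltW rho0) us.
  rewrite !powR_mulrn ?ell_norm_ge0 ?(ltW rho0)// -ler_pdivlMr ?exprn_gt0// => /le_trans; apply.
  rewrite /D1 expr_div_n ler_wpM2r ?invr_ge0 ?sqr_ge0//.
  by rewrite lerXn2r ?nnegrE ?ell_norm_ge0.
have cE j : (count (E^~ j) L)%:R <= D2.
  apply: (@le_trans _ _ (count (fun l => eta <= modulus (al l j)) L)%:R).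
    by rewrite ler_nat; apply: sub_count => l /andP[].
  have := count_large (A (unit_vector q j)) (ltW eta0) uL.
  rewrite -ler_pdivlMr ?powR_gt0// => /le_trans; apply.
  rewrite /D2 powRM ?invr_ge0 ?(ltW eta0)// -powR_inv1 ?(ltW eta0)// -powRrM mulN1r powRN ler_wpM2r ?invr_ge0 ?powR_ge0//.
  by apply: ge0_ler_powR; rewrite ?nnegrE ?ell_norm_ge0 ?(ltW q0).
have D10 : 0 <= D1 by rewrite sqr_ge0.
have D20 : 0 <= D2 by rewrite powR_ge0.
(* [S1]: small coordinates of [y l]; [S2]: small entries of [A]; [S3], [S4]: blocks below and
   above [n]. *)
pose S1 := \sum_(l <- L) (A (incl (y l)) l - \sum_(j <- iota 0 N | big l j) y l j * al l j).
pose S2 := \sum_(l <- L) \sum_(j <- iota 0 N | big l j && ~~ (eta <= modulus (al l j))) y l j * al l j.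
pose S3 := \sum_(l <- L) \sum_(j <- iota 0 N | E l j && (block j < n)%N) y l j * al l j.
pose S4 := \sum_(l <- L) \sum_(j <- iota 0 N | E l j && ~~ (block j < n)%N) y l j * al l j.
have -> : \sum_(l <- L) A (incl (T (B (fvec l)))) l = S1 + S2 + S3 + S4.
  rewrite /S1 /S2 /S3 /S4 -!big_split/=; apply: eq_bigr => l _.
  rewrite -addrA -bigID -addrA.
  rewrite [X in _ + X]addrC /E -bigID subrK//.
have h1 : modulus S1 <= (d n ^ 2 * r n)%:R * (CA * (rho `^ ((q : R) - 2) * C1 ^+ 2) `^ (q : R)^-1).
  apply: le_trans (modulus_sum _ _ _) _.
  rewrite -sL mulr_natl -[leRHS]iter_addr_0 -count_predT -big_const_seq big_seq [leRHS]big_seq.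
  apply: ler_sum => l lL; apply: le_trans (truncation_error q_gt2 A l rho0 (fun j => tail l j lL)) _.
  rewrite ler_wpM2l//; apply: ge0_ler_powR; rewrite ?nnegrE ?invr_ge0 ?(ltW q0) ?mulr_ge0 ?powR_ge0 ?sqr_ge0 ?ell_norm_ge0//.
  by rewrite ler_wpM2l ?powR_ge0// lerXn2r ?nnegrE ?ell_norm_ge0.
have h2 : modulus S2 <= (d n ^ 2 * r n)%:R * (D1 * (C1 * eta)).
  apply: le_trans (modulus_sum _ _ _) _.
  rewrite -sL mulr_natl -[leRHS]iter_addr_0 -count_predT -big_const_seq.
  apply: ler_sum => l _; apply: le_trans (modulus_sum _ _ _) _.
  apply: (@le_trans _ _ (\sum_(j <- iota 0 N | big l j && ~~ (eta <= modulus (al l j))) C1 * eta)).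
    apply: ler_sum => j /andP[_]; rewrite -ltNge => /ltW h.
    by rewrite modulusM ler_pM ?modulus_ge0.
  rewrite big_const_seq iter_addr_0 -[leLHS]mulr_natl ler_wpM2r ?mulr_ge0 ?(ltW eta0)//.
  apply: le_trans (cbig l _ (iota_uniq 0 N)).
  by rewrite ler_nat; apply: sub_count => j /andP[].
have yn0 l j : E l j -> M (block j) && (j \in lines (block j)).
  move=> /andP[h _]; apply: (@T_support (B (fvec l))).
  by apply: contraTneq h => y0; rewrite /big -ltNge /y y0 modulus0.
have h3 : modulus S3 <= (lines_below n)%:R * (D2 * (C1 * CA)).
  rewrite /S3 (exchange_big_dep predT)//=; apply: le_trans (modulus_sum _ _ _) _.
  pose J := [seq j <- iota 0 N | (block j < n)%N && (j \in lines (block j))].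
  apply: (@le_trans _ _ (\sum_(j <- J) D2 * (C1 * CA))).
    rewrite /J big_filter [leRHS]big_mkcond/=; apply: ler_sum => j _.
    have [/andP[jn jl]|h] := ifPn.
      apply: le_trans (modulus_sum _ _ _) _.
      apply: (@le_trans _ _ (\sum_(l <- L | E l j && (block j < n)%N) C1 * CA)).
        by apply: ler_sum => l _; rewrite modulusM ler_pM ?modulus_ge0.
      rewrite big_const_seq iter_addr_0 -[leLHS]mulr_natl ler_wpM2r ?mulr_ge0//.
      apply: le_trans (cE j); rewrite ler_nat; apply: sub_count => l /andP[]//.
    rewrite big_pred0 ?modulus0// => l; apply/negP => /andP[/yn0 /andP[_ jl] jn].
    by rewrite jn jl in h.
  rewrite big_const_seq iter_addr_0 count_predT -[leLHS]mulr_natl ler_wpM2r ?mulr_ge0//.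
  rewrite ler_nat; apply: count_lines_below; rewrite ?seq.filter_uniq ?iota_uniq// => j.
  by rewrite mem_filter => /andP[].
(* Coordinates in blocks not below [n] that are large, with a large entry of $A$, for some line;
   there are at most [D1] per line. *)
pose J := [seq j <- iota 0 N | ~~ (block j < n)%N && has (E^~ j) L].
have uJ : uniq J by rewrite seq.filter_uniq ?iota_uniq.
have sJ : (size J)%:R <= (d n ^ 2 * r n)%:R * D1.
  apply: (@le_trans _ _ (\sum_(j <- J) \sum_(l <- L) (E l j)%:R)).
    rewrite -[size J]count_predT -[X in X <= _]iter_addr_0 -big_const_seq big_seq [leRHS]big_seq.
    apply: ler_sum => j; rewrite mem_filter => /andP[/andP[_ /hasP[l lL Elj]] _].
    by rewrite (bigD1_seq l)//= Elj lerDl sumr_ge0.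
  rewrite exchange_big/= -sL mulr_natl -[leRHS]iter_addr_0 -count_predT -big_const_seq.
  apply: ler_sum => l _; apply: le_trans (cbig l _ uJ).
  rewrite -natr_sum ler_nat -sum1_count [leqRHS]big_mkcond; apply: leq_sum => j _.
  by rewrite /E; case: (big l j) => //=; exact: leq_b1.
(* The block [n] itself is excluded, as $T$ vanishes there. In a higher block $m$, the size of [J]
   is at most $m$ times the number of lines below $m$, because $D_1\le n<m$; so [J] is a set of few
   lines. *)
have Jr j : j \in J -> (d (block j))%:R `^ pc * (size J)%:R <= (r (block j))%:R.
  rewrite mem_filter => /andP[/andP[nj /hasP[l lL Elj]] _].
  have nlt : (n < block j)%N.
    rewrite ltn_neqAle leqNgt nj andbT; apply: contraNneq Mn => ->.
    by have /andP[] := yn0 _ _ Elj.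
  apply: le_trans (r_large (block j)); rewrite ler_wpM2l ?powR_ge0//.
  apply: (le_trans sJ); rewrite mulrC [leRHS]natrM ler_pM ?ler_nat ?lines_below_lt//.
  by apply: le_trans D1n _; rewrite ler_nat ltnW.
have h4 : modulus S4 <= (D2 * CA) * (lam^-1 * (2 * ((d n ^ 2 * r n)%:R * D1) +
       (lam * opnorm B) `^ p * (4 * (d n * r n)%:R * Num.sqrt (d n)%:R `^ p))).
  pose c l j : K := if E l j then al l j else 0.
  have -> : S4 = \sum_(l <- L) \sum_(j <- J) c l j * T (B (fvec l)) j.
    rewrite /S4 big_seq [RHS]big_seq; apply: eq_bigr => l lL.
    rewrite /J big_filter big_mkcond [RHS]big_mkcond/=; apply: eq_bigr => j _.
    rewrite /c; have [Elj|nE] := boolP (E l j); last by rewrite mul0r if_same.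
    have -> : has (E^~ j) L by apply/hasP; exists l.
    by rewrite andbT mulrC.
  apply: le_trans (bilinear_bound B lam0 uJ (beta := D2 * CA) _ Jr) _.
    move=> j; apply: (@le_trans _ _ (\sum_(l <- L | E l j) CA)).
      rewrite [leRHS]big_mkcond/=; apply: ler_sum => l _; rewrite /c.
      by case: ifP => // _; rewrite modulus0.
    by rewrite big_const_seq iter_addr_0 -[leLHS]mulr_natl ler_wpM2r.
  rewrite ler_wpM2l ?mulr_ge0// ler_wpM2l ?invr_ge0 ?(ltW lam0)// lerD2r ler_wpM2l//.
apply: le_trans (modulusD _ _) _; apply: lerD h4.
apply: le_trans (modulusD _ _) _; apply: lerD h3.
by apply: le_trans (modulusD _ _) _; rewrite mulrDr; apply: lerD.
Qed.

Context (dE : forall n, d n = n.+1).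

Lemma nat_above (x : R) : exists N, forall n, (N <= n)%N -> x <= n%:R.
Proof.
exists (Num.truncn x).+1 => n; rewrite -(ler_nat R); apply: le_trans.
by rewrite ltW// truncnS_gt.
Qed.

(** This is $d^{p/2}=o(d)$, where $p<2$ is essential: with $z=\sqrt d$, $z^p=z^2/z^{2-p}$. *)
Lemma sqrt_powR_small (eps : R) : 0 < eps ->
  exists N, forall n, (N <= n)%N -> Num.sqrt n.+1%:R `^ p <= eps * n.+1%:R.
Proof.
move=> eps0; have p2 : 0 < 2 - (p : R) by rewrite subr_gt0.
have [N HN] := nat_above ((eps^-1 `^ (2 - (p : R))^-1) ^+ 2).
exists N => n /HN h; set z := Num.sqrt _.
have zz : z ^+ 2 = n.+1%:R by rewrite sqr_sqrtr.
have z0 : 0 < z by rewrite sqrtr_gt0.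
have e1 : eps^-1 <= z `^ (2 - (p : R)).
  rewrite -[leLHS](@powR_invK _ (2 - (p : R))^-1) ?invr_gt0 ?invr_ge0 ?(ltW eps0)// invrK.
  apply: ge0_ler_powR; rewrite ?nnegrE ?powR_ge0 ?(ltW p2) ?(ltW z0)//.
  rewrite -ler_sqr ?nnegrE ?powR_ge0 ?(ltW z0)// zz; apply: le_trans h _.
  by rewrite ler_nat.
rewrite -zz -powR_mulrn ?(ltW z0)// -[2%:R](subrK (p : R)) powRD; last by rewrite gt_eqF ?implybT// subrK.
rewrite mulrA ler_peMl ?powR_ge0//.
by rewrite -ler_pdivrMl ?mulr1.
Qed.

Lemma lines_below_small n : (n * lines_below n <= d n ^ 2 * r n)%N.
Proof.
have h : (n * lines_below n)%:R <= (r n)%:R :> R.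
  apply: le_trans (r_large n); rewrite ler_peMl//.
  have {1}-> : 1 = 1 `^ pc :> R by rewrite powR1.
  by apply: ge0_ler_powR; rewrite ?nnegrE ?ler1n ?(ltW (conj_exp_gt0 p_gt1 p_lt2)).
move: h; rewrite ler_nat => /leq_trans; apply.
by rewrite leq_pmull// expn_gt0 d_gt0.
Qed.

(** The parameters $\rho$, $\eta$, $\lambda$ are chosen in this order, independently of [n]; then
    each of the five terms of [trace_bound] is at most $\delta/5$ per line once [n] is large. *)
Lemma trace_vanish (A : blinop (ell k q) (ell k q)) (B : blinop (ell k p) (ell k p)) (delta : R) :
  0 < delta -> exists N, forall n, (N <= n)%N -> ~~ M n ->
  modulus (\sum_(l <- lines n) A (incl (T (B (fvec l)))) l) <= delta * (d n ^ 2 * r n)%:R.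
Proof.
move=> delta0; have q0 := exponent_gt0 q.
pose CA := opnorm A; have CA0 : 0 <= CA := opnorm_ge0 A.
pose C1 := opnorm T * opnorm B + 1.
have C10 : 0 < C1 by rewrite ltr_wpDl// mulr_ge0 ?opnorm_ge0.
have d5 : 0 < delta / 5 by rewrite divr_gt0.
pose w := delta / 5 / (CA + 1).
have w0 : 0 < w by rewrite divr_gt0// ltr_wpDl.
have q2 : 0 < (q : R) - 2 by rewrite subr_gt0.
(* Solution of $\rho^{q-2}C_1^2=w^q$, so that the truncation error is $\|A\|w\le\delta/5$. *)
pose rho := (w `^ q / C1 ^+ 2) `^ ((q : R) - 2)^-1.
have rho0 : 0 < rho by rewrite powR_gt0// divr_gt0 ?powR_gt0 ?exprn_gt0.
have rhoE : rho `^ ((q : R) - 2) = w `^ q / C1 ^+ 2.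
  by rewrite /rho -powRrM mulVf ?gt_eqF// powRr1// divr_ge0 ?powR_ge0 ?sqr_ge0.
have t1 : CA * (rho `^ ((q : R) - 2) * C1 ^+ 2) `^ (q : R)^-1 <= delta / 5.
  rewrite rhoE divfK ?expf_neq0 ?gt_eqF// powR_invK ?(ltW w0)//.
  by rewrite /w mulrCA ler_piMr ?(ltW d5)// ler_pdivrMr ?ltr_wpDl// mul1r lerDl.
pose D1 := (C1 / rho) ^+ 2; have D10 : 0 <= D1 by rewrite sqr_ge0.
pose eta := delta / 5 / (D1 * C1 + 1).
have DC0 : 0 < D1 * C1 + 1 by rewrite ltr_wpDl// mulr_ge0 ?(ltW C10).
have eta0 : 0 < eta by rewrite divr_gt0.
have t2 : D1 * (C1 * eta) <= delta / 5.
  by rewrite /eta mulrA mulrCA ler_piMr ?(ltW d5)// ler_pdivrMr// mul1r lerDl.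
pose D2 := (CA / eta) `^ q; have D20 : 0 <= D2 by rewrite powR_ge0.
have [N3 HN3] := nat_above (D2 * (C1 * CA) / (delta / 5)).
(* Chosen so that the term counting the elements of [J] is small; the growing power of $\lambda$ in
   the random term is compensated by $d^{p/2}=o(d)$. *)
pose lam := 2 * D2 * CA * D1 / (delta / 5) + 1.
have X0 : 0 <= 2 * D2 * CA * D1 by apply: mulr_ge0 => //; apply: mulr_ge0 => //; apply: mulr_ge0.
have lam0 : 0 < lam by rewrite ltr_wpDl// divr_ge0 ?(ltW d5).
have t4 : D2 * CA * (lam^-1 * (2 * D1)) <= delta / 5.
  rewrite (_ : _ * _ = 2 * D2 * CA * D1 / lam); last by ring.
  by rewrite ler_pdivrMr// -ler_pdivrMl// mulrC lerDl.
pose X := D2 * CA * (lam^-1 * ((lam * opnorm B) `^ p * 4)).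
have XX0 : 0 <= X.
  apply: mulr_ge0; first exact: mulr_ge0.
  by rewrite mulr_ge0 ?invr_ge0 ?(ltW lam0)// mulr_ge0 ?powR_ge0.
have [N5 HN5] := @sqrt_powR_small (delta / 5 / (X + 1)) ltac:(by rewrite divr_gt0// ltr_wpDl).
have [N1 HN1] := nat_above D1.
exists (maxn N1 (maxn N3 (maxn N5 1))) => n; rewrite !geq_max => /and4P[n1 n3 n5 n0] Mn.
have C1b : opnorm T * opnorm B <= C1 by rewrite lerDl.
apply: le_trans (trace_bound A Mn rho0 eta0 lam0 C1b (HN1 n n1)) _.
rewrite -/CA -/D1 -/D2; set L := (d n ^ 2 * r n)%:R.
have L0 : 0 <= L by rewrite ler0n.
have h12 : L * (CA * (rho `^ ((q : R) - 2) * C1 ^+ 2) `^ (q : R)^-1 + D1 * (C1 * eta)) <=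
    L * (delta / 5 + delta / 5) by rewrite ler_wpM2l// lerD.
have h3 : (lines_below n)%:R * (D2 * (C1 * CA)) <= L * (delta / 5).
  have := HN3 n n3; rewrite ler_pdivrMr// => h.
  apply: le_trans (ler_wpM2l (ler0n _ _) h) _.
  rewrite [leLHS]mulrA; apply: ler_wpM2r; first exact: ltW.
  by rewrite -natrM ler_nat mulnC lines_below_small.
have h4 : D2 * CA * (lam^-1 * (2 * (L * D1))) <= L * (delta / 5).
  rewrite (_ : _ * _ = L * (D2 * CA * (lam^-1 * (2 * D1)))); last by ring.
  by rewrite ler_wpM2l.
have h5 : D2 * CA * (lam^-1 * ((lam * opnorm B) `^ p * (4 * (d n * r n)%:R * Num.sqrt (d n)%:R `^ p))) <=
   L * (delta / 5).
  set Z := Num.sqrt _ `^ p.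
  have -> : D2 * CA * (lam^-1 * ((lam * opnorm B) `^ p * (4 * (d n * r n)%:R * Z))) =
     (d n * r n)%:R * (X * Z) by rewrite /X; ring.
  have hZ : X * Z <= delta / 5 * (d n)%:R.
    have := HN5 n n5; rewrite -dE -/Z => h; apply: le_trans (ler_wpM2l XX0 h) _.
    rewrite mulrA ler_wpM2r// mulrCA ler_piMr ?(ltW d5)//.
    by rewrite ler_pdivrMr ?ltr_wpDl// mul1r lerDl.
  apply: le_trans (ler_wpM2l (ler0n _ _) hZ) _.
  rewrite le_eqVlt; apply/orP; left; apply/eqP.
  by rewrite /L !natrM; ring.
rewrite (mulrDr lam^-1) (mulrDr (D2 * CA)).
have -> : delta * L = L * (delta / 5 + delta / 5) + L * (delta / 5) + (L * (delta / 5) + L * (delta / 5)).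
  by field.
by apply: lerD; apply: lerD.
Qed.

Lemma trace_vanish_sum (s : seq (blinop (ell k q) (ell k q) * blinop (ell k p) (ell k p))) (delta : R) :
  0 < delta -> exists N, forall n, (N <= n)%N -> ~~ M n ->
  modulus (\sum_(l <- lines n) (\sum_(c <- s) blin_comp c.1 (blin_comp (blin_comp incl T) c.2)) (fvec l) l)
    <= delta * (d n ^ 2 * r n)%:R.
Proof.
elim: s delta => [|c s IH] delta delta0.
  exists 0%N => n _ _; rewrite big_nil big1 ?modulus0 ?mulr_ge0 ?(ltW delta0)//.
have d2 : 0 < delta / 2 by rewrite divr_gt0.
have [N1 H1] := IH _ d2; have [N2 H2] := trace_vanish c.1 c.2 d2.
exists (maxn N1 N2) => n; rewrite geq_max => /andP[n1 n2] Mn.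
rewrite (eq_bigr (fun l => c.1 (incl (T (c.2 (fvec l)))) l +
   (\sum_(c <- s) blin_comp c.1 (blin_comp (blin_comp incl T) c.2)) (fvec l) l)); last first.
  by move=> l _; rewrite big_cons.
rewrite big_split; apply: le_trans (modulusD _ _) _.
rewrite (splitr delta) mulrDl; apply: lerD; [exact: H2|exact: H1].
Qed.

(** A line has $r$ points, and $r\cdot r^{-1/p'}r^{-1/p}=1$. *)
Lemma line_vector_dual n l : l \in lines n ->
  of_real k (weight l) * \sum_(u <- points l) fvec l u = 1.
Proof.
move=> ln; rewrite big_seq (eq_bigr (fun=> of_real k ((r n)%:R `^ (- (p : R)^-1)))); last first.
  by move=> u ul; rewrite ell_finE ul (block_lines_block ln).
rewrite -big_seq big_const_seq iter_addr_0 count_predT (size_points_block ln).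
rewrite -[_ *+ _]mulr_natr -(@of_real_nat R k) -!of_realM /weight (block_lines_block ln).
have rn0 : 0 < (r n)%:R :> R by rewrite ltr0n.
rewrite mulrA -powRD; last by rewrite (gt_eqF rn0) implybT.
by rewrite -opprD addrC conj_expE// powR_inv1 ?ler0n// mulVf ?gt_eqF// of_real1.
Qed.

(** The average of $(Sf_l)_l$ over a far block in $M'$ but not in $M$ is 1 at $T'$ and at most $1/4$
    at a sum factoring through $T$. An approximation within $1/2$ would give $1\le1/2+1/4$. *)
Lemma not_in_ideal (M' : nat -> bool) (T' : blinop (ell k p) ell2) :
  (forall x i, T' x i =
     if M' (block i) then of_real k (weight i) * \sum_(u <- points i) x u else 0) ->
  (forall N, exists n, [/\ (N <= n)%N, M' n & ~~ M n]) ->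
  ~ @ideal_through R k (ell k p) (ell k q) _ _ (blin_comp incl T) (blin_comp incl T').
Proof.
move=> TE' inf /closure_opnormP /(_ (1 / 2)) []; first by rewrite divr_gt0.
move=> S /factor_sumsP[s SE] hS.
have [N HN] := @trace_vanish_sum s (1 / 4) ltac:(by rewrite divr_gt0).
have [n [Nn M'n Mn]] := inf N.
have := HN n Nn Mn; rewrite -SE => h1.
set L := (d n ^ 2 * r n)%N in h1.
have L0 : (0 < L)%N by rewrite muln_gt0 expn_gt0 d_gt0 r_gt0.
have sL : size (lines n) = L := size_block_lines d r n.
have h2 : \sum_(l <- lines n) blin_comp incl T' (fvec l) l = L%:R.
  rewrite big_seq (eq_bigr (fun=> 1)); last first.
    move=> l ln; rewrite -[LHS]/(T' (fvec l) l) TE' (block_lines_block ln) M'n.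
    exact: (line_vector_dual ln).
  by rewrite -big_seq big_const_seq iter_addr_0 count_predT sL.
have h3 : modulus (\sum_(l <- lines n) (blin_comp incl T' - S) (fvec l) l) <= 1 / 2 * L%:R.
  apply: le_trans (modulus_sum _ _ _) _.
  rewrite mulr_natr -sL -count_predT -iter_addr_0 -big_const_seq; apply: ler_sum => l _.
  apply: le_trans (ell_norm_coord _ _) _; apply: le_trans (ell_norm_blin _ _) _.
  have fl := line_vector_norm k p d r l; apply: le_trans (ler_wpM2l (opnorm_ge0 _) fl) _.
  by rewrite mulr1 ltW.
have h4 : modulus (L%:R : K) <= 1 / 2 * L%:R + 1 / 4 * L%:R.
  apply: le_trans (lerD h3 h1); apply: le_trans (modulusD _ _).
  rewrite -big_split/= -h2 le_eqVlt; apply/orP; left; apply/eqP; congr (modulus _).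
  by apply: eq_bigr => l _; rewrite -[X in X + _]/(blin_comp incl T' (fvec l) l - S (fvec l) l) subrK.
move: h4; rewrite -(@of_real_nat R k) modulus_of_real ger0_norm//.
have : 0 < L%:R :> R by rewrite ltr0n.
lra.
Qed.

End trace_estimate.

(** * The chain of ideals *)

Section parameters.
Context {R : realType} (e : nat).

(* The length of the lines of block [n], given the total number [N] of lines of the lower blocks. *)
Definition next_length (n N : nat) : nat := n.+1 ^ e * (n.+1 ^ (4 * e) + n * N).

(** The length of the lines in a block depends on the number of lines below it; recursion on that
    number avoids a course-of-values recursion on the lengths. *)
Fixpoint line_count (n : nat) : nat :=
  if n is n'.+1 then line_count n' + n'.+1 ^ 2 * next_length n' (line_count n') else 0%N.

Definition line_length (n : nat) : nat := next_length n (line_count n).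

Lemma line_length_gt0 n : (0 < line_length n)%N.
Proof. by rewrite /line_length /next_length muln_gt0 expn_gt0/= addn_gt0 expn_gt0. Qed.

Lemma lines_belowE n : lines_below succn line_length n = line_count n.
Proof.
elim: n => [|n IH]; first by rewrite /lines_below big_ord0.
by rewrite /lines_below big_ord_recr/= -/(lines_below succn line_length n) IH.
Qed.

Lemma nat_powR_le (c : R) n : c <= e%:R -> n.+1%:R `^ c <= (n.+1 ^ e)%:R :> R.
Proof. by move=> ce; rewrite natrX -powR_mulrn// ler_powR// ler1n. Qed.

(** The summand $nN$ of [next_length] serves this bound; the power $(n+1)^{4e}$ serves
    [line_length_threshold]. *)
Lemma line_length_large (c : R) n : c <= e%:R ->
  n.+1%:R `^ c * (n * lines_below succn line_length n)%:R <= (line_length n)%:R :> R.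
Proof.
move=> ce; rewrite lines_belowE /line_length /next_length [leRHS]natrM.
by rewrite ler_pM ?powR_ge0 ?nat_powR_le// ler_nat leq_addl.
Qed.

(** With $d=n+1$ and $t=d^{-e}$, the condition $d^ct^{c-2}\le1$ amounts to $c\le e(c-2)$, and
    $t^{-4}=d^{4e}$. *)
Definition coef_threshold (n : nat) : R := (n.+1 ^ e)%:R^-1.

Lemma coef_threshold_gt0 n : 0 < coef_threshold n.
Proof. by rewrite invr_gt0 ltr0n expn_gt0. Qed.

Lemma line_length_threshold (c : R) n : c <= e%:R ->
  n.+1%:R `^ c * coef_threshold n ^- 4 <= (line_length n)%:R.
Proof.
move=> ce; rewrite /line_length /next_length [leRHS]natrM.
rewrite /coef_threshold exprVn invrK ler_pM ?powR_ge0 ?nat_powR_le//.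
by rewrite -natrX ler_nat -expnM mulnC leq_addr.
Qed.

Lemma coef_threshold_small (c : R) n : 2 < c -> c <= e%:R * (c - 2) ->
  n.+1%:R `^ c * coef_threshold n `^ (c - 2) <= 1.
Proof.
move=> c2 ce; rewrite /coef_threshold natrX -powR_inv1 -?powR_mulrn// -!powRrM.
rewrite -powRD ?pnatr_eq0 ?implybT//.
apply: (@le_trans _ _ (n.+1%:R `^ 0)); last by rewrite powRr0.
by apply: ler_powR; rewrite ?ler1n//; lra.
Qed.

End parameters.

(** * Operators acting on coordinates *)

Section coordinate_operators.
Context {R : realType} {k : scalar_kind}.
Local Notation K := (scalar_field R k).
Local Notation modulus := (@modulus R k).

Lemma ell_norm_powR_le1 (p : exponent R) (x : ell k p) : ell_norm x <= 1 -> ell_norm x `^ p <= 1.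
Proof. by move=> x1; rewrite powR_le1 ?ell_norm_ge0 ?x1// ltW// exponent_gt0. Qed.

(** It provides the identity, the projections onto sets of blocks and the extraction of a
    subsequence. *)
Lemma reindex_operator (q : exponent R) (P : nat -> bool) (f : nat -> nat) : injective f ->
  exists A : blinop (ell k q) (ell k q), forall x i, A x i = if P i then x (f i) else 0.
Proof.
move=> fI; apply: (@blin_of_bound R k q q (fun x i => if P i then x (f i) else 0) 1).
  by move=> a x y i; case: ifP => _; rewrite ?mulr0 ?addr0.
move=> x x1 N; apply: le_trans (ell_norm_powR_le1 x1).
have uf : uniq [seq f i | i <- iota 0 N] by rewrite map_inj_uniq ?iota_uniq.
apply: le_trans (ell_norm_powR_ge x uf); rewrite big_map; apply: ler_sum => i _.
by case: ifP => // _; rewrite modulus0 powR0 ?powR_ge0// gt_eqF ?exponent_gt0.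
Qed.

Context (p : exponent R) (d r : nat -> nat) (r_gt0 : forall n, (0 < r n)%N).
Local Notation points := (points d r).

(* [x] is sent to the sum of the [x j *: line_vector (g j)]; the [g j] are pairwise disjoint
   because they lie in different blocks. *)
Lemma spread_operator (g h : nat -> nat) : cancel (fun j => block (g j)) h ->
  exists B : blinop (ell k p) (ell k p), forall x j u, u \in points (g j) ->
    B x u = of_real k ((r (block (g j)))%:R `^ (- (p : R)^-1)) * x j.
Proof.
move=> gK; have p0 := exponent_gt0 p.
(* A block contains at most one of the lines [g j], and [h] recovers [j] from the block. *)
pose c u := u \in points (g (h (block u))).
pose phi (x : ell k p) u : K := if c u then
  of_real k ((r (block u))%:R `^ (- (p : R)^-1)) * x (h (block u)) else 0.
have [|x x1 N|B BE] := @blin_of_bound R k p p phi 1.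
- by move=> a x y u; rewrite /phi; case: ifP => _; [rewrite ell_coordD ell_coordZ; ring|rewrite mulr0 addr0].
- apply: le_trans (ell_norm_powR_le1 x1).
  pose P := [seq u <- iota 0 N | c u].
  have uP : uniq P by rewrite seq.filter_uniq ?iota_uniq.
  apply: (@le_trans _ _ (\sum_(u <- P) (r (block u))%:R^-1 * modulus (x (h (block u))) `^ p)).
    rewrite /P big_filter [leRHS]big_mkcond; apply: ler_sum => u _; rewrite /phi /=.
    case: ifP => _; last by rewrite modulus0 powR0// gt_eqF.
    rewrite modulusM modulus_of_real ger0_norm ?powR_ge0// powRM ?powR_ge0 ?modulus_ge0//.
    by rewrite -powRrM mulNr mulVf ?gt_eqF// powR_inv1.
  pose s := undup [seq h (block u) | u <- P].
  apply: le_trans (ell_norm_powR_ge x (undup_uniq _ : uniq s)).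
  apply: (@le_trans _ _ (\sum_(j <- s) \sum_(u <- P | u \in points (g j)) (r (block (g j)))%:R^-1 * modulus (x j) `^ p)).
    rewrite (exchange_big_dep predT)//= big_seq [leRHS]big_seq; apply: ler_sum => u.
    move=> uP'; have := uP'; rewrite mem_filter => /andP[cu _].
    have hs : h (block u) \in s by rewrite mem_undup; apply/mapP; exists u.
    rewrite -big_filter (bigD1_seq (h (block u))) ?mem_filter ?hs ?andbT ?seq.filter_uniq ?undup_uniq//=.
    rewrite -(block_point cu); apply: ler_wpDr; last exact: lexx.
    apply: sumr_ge0 => j _.
    by rewrite mulr_ge0 ?invr_ge0 ?powR_ge0.
  apply: ler_sum => j _; rewrite big_const_seq iter_addr_0 -[_ *+ count _ _]mulr_natl mulrA.
  rewrite ler_piMl ?powR_ge0// ler_pdivrMr ?ltr0n// mul1r ler_nat.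
  apply: leq_trans (size_points_le d r (g j)); rewrite -size_filter.
  apply: uniq_leq_size; first by rewrite seq.filter_uniq.
  by move=> u; rewrite mem_filter => /andP[].
- exists B => x j u uj; rewrite BE /phi /c (block_point uj) gK uj//.
Qed.

End coordinate_operators.

Lemma injective_unbounded (f : nat -> nat) : injective f -> forall N, exists m, (N <= f m)%N.
Proof.
move=> fI N; apply: contrapT => H.
have fN m : (f m < N)%N by rewrite ltnNge; apply/negP => h; apply: H; exists m.
have : (size [seq f i | i <- iota 0 N.+1] <= size (iota 0 N))%N.
  apply: uniq_leq_size; first by rewrite map_inj_uniq ?iota_uniq.
  by move=> _ /mapP[m _ ->]; rewrite mem_iota add0n fN.
by rewrite size_map !size_iota ltnn.
Qed.

(** * A chain of sets of blocks indexed by the reals *)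

Section block_sets.
Context {R : realType}.

(* The even blocks, which are always present, provide the factorization of [ell_incl k p q];
   every rational labels infinitely many odd blocks. *)
Definition block_set (t : R) (n : nat) : bool :=
  odd n ==> if unpickle n./2 is Some c then ratr (c : rat * nat).1 < t else false.

Lemma block_set_double t n : block_set t n.*2.
Proof. by rewrite /block_set odd_double. Qed.

Lemma block_set_sub t t' n : t <= t' -> block_set t n -> block_set t' n.
Proof.
move=> tt'; rewrite /block_set; case: odd => //=; case: unpickle => //= c.
by move=> /lt_le_trans; apply.
Qed.

(** A rational strictly between [t] and [t'] labels infinitely many odd blocks, all of them in the
    difference. *)
Lemma block_set_diff t t' N : t < t' -> exists n, [/\ (N <= n)%N, block_set t' n & ~~ block_set t n].
Proof.
move=> tt'; have [x] := rat_in_itvoo tt'; rewrite in_itv/= => /andP[tx xt'].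
pose f m := (pickle ((x, m) : rat * nat)).*2.+1.
have fI : injective f.
  by move=> m m' [] /double_inj /(pcan_inj (@pickleK _)) [].
have [m Nm] := injective_unbounded fI N; exists (f m).
have half_odd a : (a.*2.+1)./2 = a by rewrite /= uphalf_double.
rewrite /block_set /f oddS odd_double half_odd pickleK implyTb xt' implyTb; split => //.
by rewrite -leNgt ltW.
Qed.

End block_sets.

(** * The chain of ideals indexed by the real line *)

Theorem theorem2 (R : realType) (k : scalar_kind) (p q : exponent R)
    (p_gt1 : 1 < (p : R)) (p_lt2 : (p : R) < 2) (q_gt2 : 2 < (q : R)) :
  exists F : set (set (blinop (ell k p) (ell k q))),
    [/\ (F #= [set: R])%card,
        total_on F subset &
        forall J, F J ->
          [/\ is_closed_ideal J,
              ideal_through (ell_incl k p q (lt_trans p_lt2 q_gt2)) `<=` J &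
              J `<=` ideal_through (ell_incl k (exponent2 R) q q_gt2)]].
Proof.
pose pc := conj_exp p.
have pc2 : 2 < pc := conj_exp_gt2 p_gt1 p_lt2.
have pc2' : 0 < pc - 2 by rewrite subr_gt0.
(* The exponent [e] must exceed both $p'$, for the line lengths, and $p'/(p'-2)$, for the
   coefficient threshold. *)
have [N1 HN1] := nat_above pc; have [N2 HN2] := nat_above (pc / (pc - 2)).
pose e := maxn N1 N2.
have e1 : pc <= e%:R := HN1 e (leq_maxl _ _).
have e2 : pc <= e%:R * (pc - 2).
  by have := HN2 e (leq_maxr _ _); rewrite ler_pdivrMr.
pose r := line_length e.
have d_gt0 n : (0 < n.+1)%N by [].
have r_gt0 n : (0 < r n)%N := line_length_gt0 e n.
pose incl := ell_incl k (exponent2 R) q q_gt2.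
have /choice[T TE] : forall t : R, exists T : blinop (ell k p) (ell k (exponent2 R)), forall x i,
    T x i = if block_set t (block i) then
      of_real k (weight r pc i) * \sum_(u <- points succn r i) x u else 0.
  move=> t; apply: (@line_operator_exists R k p succn r p_gt1 p_lt2 (block_set t) (coef_threshold e)).
  - exact: coef_threshold_gt0.
  - by move=> n; apply: coef_threshold_small.
  - by move=> n; apply: line_length_threshold.
pose I t : set (blinop (ell k p) (ell k q)) := ideal_through (blin_comp incl (T t)).
have [id_p id_pE] := @reindex_operator R k p xpredT id (@inj_id _).
have [id_q id_qE] := @reindex_operator R k q xpredT id (@inj_id _).
have I_homo t t' : t <= t' -> I t `<=` I t'.
  move=> tt'.
  (* Projection onto the blocks of [block_set t]: it turns [T t'] into [T t]. *)
  have [A AE] := @reindex_operator R k q (fun i => block_set t (block i)) id (@inj_id _).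
  apply: (@ideal_through_incl R k _ _ _ _ _ _ _ _ A id_p).
  apply: blin_ext => x; apply: ell_ext => i /=.
  rewrite -[RHS]/(A (incl (T t' (id_p x))) i) AE -[in RHS]/(T t' (id_p x) i) -[LHS]/(T t x i) !TE.
  case: ifP => // ti; rewrite (block_set_sub tt' ti); congr (_ * _).
  by apply: eq_bigr => u _; rewrite id_pE.
have I_mem t : I t (blin_comp incl (T t)).
  apply: subset_closure; have := factor_sums_seq (blin_comp incl (T t)) [:: (id_q, id_p)].
  rewrite big_seq1 /=; congr (factor_sums _ _).
  apply: blin_ext => x; apply: ell_ext => i.
  rewrite -[LHS]/(id_q (incl (T t (id_p x))) i) id_qE /=.
  by congr (T t _ i); apply: ell_ext => j; rewrite id_pE.
have I_lt t t' : t < t' -> ~ I t' `<=` I t.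
  move=> tt' sub; have := sub _ (I_mem t').
  apply: (@not_in_ideal R k p q succn r p_gt1 p_lt2 q_gt2 d_gt0 r_gt0 _ (block_set t) (T t) (TE t) _
    (block_set t') (T t') (TE t')) => //.
    by move=> n; apply: line_length_large.
  by move=> N; apply: block_set_diff.
have I_inj : injective I.
  move=> t t' tt'; apply/eqP; rewrite eq_le !leNgt; apply/andP; split; apply/negP => /I_lt; apply.
    by rewrite tt'.
  by rewrite tt'.
exists (range I); split.
- by apply: inj_card_eq => ? ? _ _; exact: I_inj.
- move=> _ _ [t _ <-] [t' _ <-]; have [tt'|/ltW tt'] := leP t t'; [left|right]; exact: I_homo.
move=> _ [t _ <-]; split; first exact: ideal_through_closed_ideal.
(* The line of slope and intercept 0 in the even block $2j$. [B] sends the $j$-th unit vector to the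
   normalized indicator of this line and [A] reads its coordinate, where [T t] takes the value 1:
   this factors the inclusion of $\ell_p$ into $\ell_q$. *)
- pose g j := triple (j.*2, 0, 0)%N.
  have gK : cancel (fun j => block (g j)) half.
    by move=> j; rewrite block_triple doubleK.
  have gI : injective g by move=> i j /triple_inj[/double_inj].
  have [B BE] := @spread_operator R k p succn r r_gt0 g half gK.
  have [A AE] := @reindex_operator R k q xpredT g gI.
  apply: (@ideal_through_incl R k _ _ _ _ _ _ _ _ A B).
  apply: blin_ext => x; apply: ell_ext => j.
  rewrite -[RHS]/(A (incl (T t (B x))) j) AE -[RHS]/(T t (B x) (g j)) TE.
  rewrite /g block_triple block_set_double -/(g j) ell_inclE.
  have gl : g j \in block_lines succn r j.*2.
    apply/block_linesP; exists 0%N, 0%N; split => //.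
    by rewrite /valid_line /= muln_gt0 r_gt0.
  rewrite -[LHS]mul1r -(@line_vector_dual R k p succn r r_gt0 _ _ gl) -mulrA mulr_suml; congr (_ * _).
  rewrite big_seq [RHS]big_seq; apply: eq_bigr => u ul; rewrite (BE x j u ul) ell_finE ul.
  by rewrite (block_lines_block gl).
(* The upper bound is immediate: [T t] itself is the right factor. *)
- apply: (@ideal_through_incl R k _ _ _ _ _ _ _ _ id_q (T t)).
  by apply: blin_ext => x; apply: ell_ext => i; rewrite -[RHS]/(id_q (incl (T t x)) i) id_qE.
Qed.
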